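(* Fix $B \in \mathbb{H}_1$ and let $X_{(u,B)},X_{(u',B)}$ be two discrete Gaussians on $\mathbb{Z}$ with the same parameter $B$ (where $u,u'\in\mathbb{C}$, $\theta(u,B)\neq0$, $\theta(u',B)\ne0$). If the first three moments of $X_{(u,B)}$ and $X_{(u',B)}$ coincide, then $X_{(u,B)}$ and $X_{(u',B)}$ have the same distribution. Furthermore, for discrete Gaussians with different parameters $B$, the first two moments are not enough in general: there exist $(u,B),(u',B')\in(\mathbb{C}\times\mathbb{H}_1)\setminus\Theta_1$ such that $X_{(u,B)}$ and $X_{(u',B')}$ have the same first two moments but different distributions.
   Context: Notation: $\mathbf{e}(x)=e^{2\pi x}$. $\mathbb{H}_1=\{B\in\mathbb{C}:\operatorname{Re}B>0\}$, $\theta\colon\mathbb{C}\times\mathbb{H}_1\to\mathbb{C}$, $\theta(u,B)=\sum_{n\in\mathbb{Z}}\mathbf{e}(-\frac12 Bn^2+nu)$, $\Theta_1=\{(u,B)\in\mathbb{C}\times\mathbb{H}_1:\theta(u,B)=0\}$. For $(u,B)\notin\Theta_1$, the (complex) discrete Gaussian distribution with parameters $(u,B)$ is the complex-valued probability distribution on $\mathbb{Z}$ given by $p_\theta(n;u,B)=\frac{1}{\theta(u,B)}\mathbf{e}(-\frac12 Bn^2+nu)$ (the values sum to $1$); $X_{(u,B)}$ denotes a random variable with this distribution. The $k$-th moment is $\mathbb{E}[X_{(u,B)}^k]=\sum_{n\in\mathbb{Z}}n^kp_\theta(n;u,B)\in\mathbb{C}$. *)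

(* Defs.v *)
From Stdlib Require Export Reals ZArith.
From Coquelicot Require Export Coquelicot.
Open Scope C_scope.

Definition Cexp (z : C) : C :=
  (exp (Re z) * cos (Im z), exp (Re z) * sin (Im z))%R.

(* There is no factor [i]: the lattice of periods of [bfe] is generated by [i]. *)
Definition bfe (x : C) : C := Cexp (2 * PI * x).

Definition CSeries (a : nat -> C) : C :=
  (Series (fun n => Re (a n)), Series (fun n => Im (a n))).

(* Sum over Z.  Every sum taken below converges absolutely when [0 < Re B],
   so the order of summation is immaterial. *)
Definition Zsum (f : Z -> C) : C :=
  CSeries (fun n => f (Z.of_nat n)) + CSeries (fun n => f (- Z.of_nat (S n))%Z).

Definition H1 (B : C) : Prop := (0 < Re B)%R.

Definition gauss_weight (u B : C) (n : Z) : C :=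
  bfe (- (1 / 2) * B * IZR n ^ 2 + IZR n * u).

Definition theta (u B : C) : C := Zsum (gauss_weight u B).

Definition Theta1 (u B : C) : Prop := H1 B /\ theta u B = 0.

Definition p_theta (n : Z) (u B : C) : C := 1 / theta u B * gauss_weight u B n.

Definition moment (k : nat) (u B : C) : C :=
  Zsum (fun n => IZR n ^ k * p_theta n u B).

Definition same_moments (m : nat) (u B u' B' : C) : Prop :=
  forall k : nat, (1 <= k <= m)%nat -> moment k u B = moment k u' B'.

Definition same_distribution (u B u' B' : C) : Prop :=
  forall n : Z, p_theta n u B = p_theta n u' B'.

(* Main.v *)
(** Write w_u for the weights with parameter B and a_x for those with parameter B/2.
    Rotating the lattice Z x Z by (n, m) -> (n + m, n - m) turns w_p(n) w_q(m) into
    a_X(n + m) a_v(n - m) with X = (p+q)/2 and v = (p-q)/2, so bilinear expressions in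
    the moments of w_p and w_q become bilinear in the even-index and odd-index halves
    A_0, A_1 of the sums of a_X and a_v.  Consequently:
    - A_0(x) A_1(y) - A_1(x) A_0(y) is, up to sign, th(x+y) th(x-y) for the odd theta
      function th, and the Wronskian A_0' A_1 - A_0 A_1' at x is a nonzero multiple of
      th(2x);
    - the variance of X_u is a Moebius function of A_0(u)/A_1(u), so equal variances
      force th(u+u') th(u-u') = 0; its derivative, the third cumulant, vanishes only if
      th(2u) = 0;
    - if th(p-q) = 0, then A'(v) = c A(v), which says that the generating functions of
      w_p and w_q differ by an exponential factor with rate c, the difference of means.
    If th(u-u') = 0, equality of the means gives c = 0.  If th(u+u') = 0, then X_u' is a
    tilt of X_{-u}; comparing third cumulants gives th(2u) = 0, so X_u is a tilt of X_{-u}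
    as well, with the same rate.

    For the second claim take u = u' = 0 and B' the conjugate of B.  The means vanish and
    the variances are conjugate, so it suffices that the variance is real for some B whose
    nome q = exp(-pi B) is not real; on the ray q = t(1 - 3i) its imaginary part changes
    sign between t = 1/10 and t = 1/5. *)

Require Import Defs.
From Stdlib Require Import Lra Lia List Permutation ClassicalEpsilon FunctionalExtensionality.
Import ListNotations.

(** * Unordered summation *)

Definition lsum {I : Type} (f : I -> C) (L : list I) : C :=
  fold_right (fun i s => f i + s) 0 L.

Definition lsum_norm {I : Type} (f : I -> C) (L : list I) : R :=
  fold_right (fun i s => Cmod (f i) + s)%R 0%R L.

(** Convergence along finite subsets ordered by inclusion: no enumeration enters, so sums can be
    transported along maps of index sets such as the rotation of Z x Z. *)
Definition has_sum {I : Type} (f : I -> C) (l : C) : Prop :=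
  forall eps : R, (0 < eps)%R -> exists L0 : list I, forall L,
    NoDup L -> incl L0 L -> (Cmod (lsum f L - l) < eps)%R.

(** [A] is the supremum of the finite absolute sums, so everything outside a suitable finite set has
    small total mass. *)
Definition has_norm_sum {I : Type} (f : I -> C) (A : R) : Prop :=
  (forall L, NoDup L -> (lsum_norm f L <= A)%R) /\
  (forall eps : R, (0 < eps)%R ->
     exists L0, NoDup L0 /\ (A - eps < lsum_norm f L0)%R).

Definition classical_eq_dec {I : Type} (x y : I) : {x = y} + {x <> y} :=
  excluded_middle_informative (x = y).

Lemma lsum_app {I} (f : I -> C) L L' : lsum f (L ++ L') = lsum f L + lsum f L'.
Proof. induction L as [|i L IH]; simpl; [ring | rewrite IH; ring]. Qed.

Lemma lsum_norm_app {I} (f : I -> C) L L' :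
  lsum_norm f (L ++ L') = (lsum_norm f L + lsum_norm f L')%R.
Proof. induction L as [|i L IH]; simpl; [ring | rewrite IH; ring]. Qed.

Lemma lsum_perm {I} (f : I -> C) L L' : Permutation L L' -> lsum f L = lsum f L'.
Proof. induction 1; simpl; [reflexivity | now rewrite IHPermutation | ring | congruence]. Qed.

Lemma lsum_norm_perm {I} (f : I -> C) L L' :
  Permutation L L' -> lsum_norm f L = lsum_norm f L'.
Proof. induction 1; simpl; [reflexivity | now rewrite IHPermutation | ring | congruence]. Qed.

Lemma lsum_norm_ge0 {I} (f : I -> C) L : (0 <= lsum_norm f L)%R.
Proof.
  induction L as [|i L IH]; simpl; [lra | pose proof (Cmod_ge_0 (f i)); lra].
Qed.

Lemma lsum_le_norm {I} (f : I -> C) L : (Cmod (lsum f L) <= lsum_norm f L)%R.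
Proof.
  induction L as [|i L IH]; simpl; [rewrite Cmod_0; lra|].
  eapply Rle_trans; [apply Cmod_triangle | lra].
Qed.

Lemma lsum_ext {I} (f g : I -> C) L :
  (forall i, In i L -> f i = g i) -> lsum f L = lsum g L.
Proof.
  induction L as [|i L IH]; intros H; simpl; [reflexivity|].
  rewrite (H i (or_introl eq_refl)), IH; [reflexivity | intros; apply H; now right].
Qed.

Lemma lsum_plus {I} (f g : I -> C) L :
  lsum (fun i => f i + g i) L = lsum f L + lsum g L.
Proof. induction L as [|i L IH]; simpl; [ring | rewrite IH; ring]. Qed.

Lemma lsum_scal {I} (c : C) (f : I -> C) L :
  lsum (fun i => c * f i) L = c * lsum f L.
Proof. induction L as [|i L IH]; simpl; [ring | rewrite IH; ring]. Qed.

Lemma lsum_map {I J} (phi : I -> J) (F : J -> C) L :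
  lsum F (map phi L) = lsum (fun i => F (phi i)) L.
Proof. induction L as [|i L IH]; simpl; [reflexivity | now rewrite IH]. Qed.

Lemma lsum_prod {I J} (f : I -> C) (g : J -> C) L M :
  lsum (fun p => f (fst p) * g (snd p)) (list_prod L M) = lsum f L * lsum g M.
Proof.
  induction L as [|i L IH]; simpl; [ring|].
  rewrite lsum_app, IH, lsum_map; simpl. rewrite lsum_scal. ring.
Qed.

Lemma lsum_norm_prod {I J} (f : I -> C) (g : J -> C) L M :
  lsum_norm (fun p => f (fst p) * g (snd p)) (list_prod L M)
  = (lsum_norm f L * lsum_norm g M)%R.
Proof.
  induction L as [|i L IH]; simpl; [ring|].
  rewrite lsum_norm_app, IH, Rmult_plus_distr_r; f_equal.
  clear; induction M as [|j M IH]; simpl; [ring|].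
  rewrite IH, Cmod_mult. ring.
Qed.

Lemma NoDup_incl_permutation {I} (L0 L : list I) :
  NoDup L0 -> incl L0 L -> exists R, Permutation L (L0 ++ R).
Proof.
  revert L; induction L0 as [|i L0 IH]; intros L Hn Hi; [now exists L|].
  inversion Hn as [|? ? Hni Hn']; subst.
  destruct (in_split i L (Hi i (or_introl eq_refl))) as (L1 & L2 & ->).
  destruct (IH (L1 ++ L2) Hn') as (R & HR).
  - intros j Hj. specialize (Hi j (or_intror Hj)).
    apply in_app_or in Hi; apply in_or_app; destruct Hi as [Hi | [Hi | Hi]]; auto.
    subst; contradiction.
  - exists R; simpl. rewrite <- HR. symmetry; apply Permutation_middle.
Qed.

Lemma lsum_norm_incl {I} (f : I -> C) L0 L :
  NoDup L0 -> incl L0 L -> (lsum_norm f L0 <= lsum_norm f L)%R.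
Proof.
  intros Hn Hi; destruct (NoDup_incl_permutation L0 L Hn Hi) as (R & HR).
  rewrite (lsum_norm_perm f _ _ HR), lsum_norm_app.
  pose proof (lsum_norm_ge0 f R); lra.
Qed.

Lemma lsum_tail {I} (f : I -> C) L0 L :
  NoDup L0 -> incl L0 L ->
  (Cmod (lsum f L - lsum f L0) <= lsum_norm f L - lsum_norm f L0)%R.
Proof.
  intros Hn Hi; destruct (NoDup_incl_permutation L0 L Hn Hi) as (R & HR).
  rewrite (lsum_norm_perm f _ _ HR), lsum_norm_app, (lsum_perm f _ _ HR), lsum_app.
  replace (lsum f L0 + lsum f R - lsum f L0) with (lsum f R) by ring.
  pose proof (lsum_le_norm f R); lra.
Qed.

Lemma incl_nodup_app {I} (L1 L2 : list I) :
  NoDup (nodup classical_eq_dec (L1 ++ L2)) /\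
  incl L1 (nodup classical_eq_dec (L1 ++ L2)) /\ incl L2 (nodup classical_eq_dec (L1 ++ L2)).
Proof.
  split; [apply NoDup_nodup | split]; intros x Hx; apply nodup_In, in_or_app; auto.
Qed.

Lemma Cmod_small_eq (z : C) : (forall eps : R, (0 < eps)%R -> (Cmod z < eps)%R) -> z = 0.
Proof.
  intros H; apply Cmod_eq_0; apply Rle_antisym; [|apply Cmod_ge_0].
  apply le_epsilon; intros e He; specialize (H e He); lra.
Qed.

Lemma has_sum_unique {I} (f : I -> C) l l' : has_sum f l -> has_sum f l' -> l = l'.
Proof.
  intros H H'. apply Ceq_minus, Cmod_small_eq. intros e He.
  destruct (H (e/2)%R) as (L1 & H1); [lra|].
  destruct (H' (e/2)%R) as (L2 & H2); [lra|].
  destruct (incl_nodup_app L1 L2) as (Hn & Hi1 & Hi2).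
  specialize (H1 _ Hn Hi1); specialize (H2 _ Hn Hi2).
  set (s := lsum f _) in *.
  replace (l - l') with (- (s - l) + (s - l')) by ring.
  eapply Rle_lt_trans; [apply Cmod_triangle|]. rewrite Cmod_opp; lra.
Qed.

Lemma has_sum_ext {I} (f g : I -> C) l : (forall i, f i = g i) -> has_sum f l -> has_sum g l.
Proof. intros H; replace g with f; [auto | now apply functional_extensionality]. Qed.

Lemma has_sum_plus {I} (f g : I -> C) l m :
  has_sum f l -> has_sum g m -> has_sum (fun i => f i + g i) (l + m).
Proof.
  intros H H' e He.
  destruct (H (e/2)%R) as (L1 & H1); [lra|].
  destruct (H' (e/2)%R) as (L2 & H2); [lra|].
  exists (L1 ++ L2); intros L Hn Hi.
  assert (Hi1 : incl L1 L) by (intros x Hx; apply Hi, in_or_app; auto).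
  assert (Hi2 : incl L2 L) by (intros x Hx; apply Hi, in_or_app; auto).
  specialize (H1 _ Hn Hi1); specialize (H2 _ Hn Hi2).
  rewrite lsum_plus.
  replace (lsum f L + lsum g L - (l + m)) with ((lsum f L - l) + (lsum g L - m)) by ring.
  eapply Rle_lt_trans; [apply Cmod_triangle|]; lra.
Qed.

Lemma has_sum_scal {I} (c : C) (f : I -> C) l :
  has_sum f l -> has_sum (fun i => c * f i) (c * l).
Proof.
  intros H e He.
  pose proof (Cmod_ge_0 c) as Hc.
  destruct (H (e / (Cmod c + 1))%R) as (L1 & H1); [apply Rdiv_lt_0_compat; lra|].
  exists L1; intros L Hn Hi. specialize (H1 _ Hn Hi).
  rewrite lsum_scal. replace (c * lsum f L - c * l) with (c * (lsum f L - l)) by ring.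
  rewrite Cmod_mult. apply Rle_lt_trans with (Cmod c * (e / (Cmod c + 1)))%R.
  - apply Rmult_le_compat_l; lra.
  - apply Rmult_lt_reg_r with (Cmod c + 1)%R; [lra|]. field_simplify; [nra | lra].
Qed.

Lemma has_sum_norm_bound {I} (f : I -> C) l M :
  has_sum f l -> (forall L, NoDup L -> (lsum_norm f L <= M)%R) -> (Cmod l <= M)%R.
Proof.
  intros H HM; apply le_epsilon; intros e He.
  destruct (H e He) as (L1 & H1).
  destruct (incl_nodup_app L1 L1) as (Hn & Hi & _).
  specialize (H1 _ Hn Hi). specialize (HM _ Hn).
  set (L := nodup _ _) in *.
  pose proof (lsum_le_norm f L).
  replace l with (lsum f L + - (lsum f L - l)) by ring.
  eapply Rle_trans; [apply Cmod_triangle|]. rewrite Cmod_opp; lra.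
Qed.

Lemma lsum_finite_support {I} (f : I -> C) L0 L :
  NoDup L0 -> NoDup L -> incl L0 L -> (forall i, In i L -> ~ In i L0 -> f i = 0) ->
  lsum f L = lsum f L0.
Proof.
  intros Hn0 Hn Hi H; destruct (NoDup_incl_permutation L0 L Hn0 Hi) as (R & HR).
  rewrite (lsum_perm f _ _ HR), lsum_app.
  enough (lsum f R = 0) as -> by ring.
  assert (HnR : NoDup (L0 ++ R)) by (eapply Permutation_NoDup; eauto).
  assert (HRz : forall i, In i R -> f i = 0).
  { intros i HiR; apply H.
    - eapply Permutation_in; [symmetry; eauto | apply in_or_app; auto].
    - intros Hi0. clear - HnR HiR Hi0.
      induction L0 as [|j L0 IH]; [easy|].
      inversion HnR; subst. destruct Hi0 as [->|Hi0]; auto.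
      apply H1, in_or_app; auto. }
  clear - HRz. induction R as [|i R IH]; simpl; [reflexivity|].
  rewrite (HRz i (or_introl eq_refl)), IH; [ring | intros; apply HRz; now right].
Qed.

Lemma has_sum_single {I} (f : I -> C) i :
  (forall j, j <> i -> f j = 0) -> has_sum f (f i).
Proof.
  intros H e He; exists [i]; intros L Hn Hi.
  rewrite (lsum_finite_support f [i] L); auto.
  - simpl. replace (f i + 0 - f i) with (RtoC 0) by ring. now rewrite Cmod_0.
  - constructor; [easy | constructor].
  - intros j _ Hj; apply H; intros ->; apply Hj; now left.
Qed.

(** [phi] need not be onto: enlarging [map phi L] by [L0] only adds points off the image, where [F]
    vanishes. The rotation of Z x Z is such a map, reaching only half of the pairs. *)
Lemma has_sum_reindex {I J} (phi : I -> J) (psi : J -> I) (F : J -> C) l :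
  (forall i, psi (phi i) = i) -> (forall j, phi (psi j) <> j -> F j = 0) ->
  has_sum F l -> has_sum (fun i => F (phi i)) l.
Proof.
  intros Hpp H0 H e He. destruct (H e He) as (L0 & HL0).
  exists (map psi L0); intros L Hn Hi.
  assert (Hinj : forall i i', phi i = phi i' -> i = i')
    by (intros i i' E; rewrite <- (Hpp i), <- (Hpp i'), E; reflexivity).
  destruct (incl_nodup_app (map phi L) L0) as (Hn' & Hi1 & Hi2).
  specialize (HL0 _ Hn' Hi2).
  rewrite (lsum_finite_support F (map phi L)) in HL0; auto.
  - now rewrite lsum_map in HL0.
  - clear - Hn Hinj. induction Hn; simpl; constructor; auto.
    intros Hin; apply in_map_iff in Hin; destruct Hin as (y & E & Hy).
    apply Hinj in E; subst; contradiction.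
  - intros j Hj Hnj; apply H0; intros E; apply Hnj.
    apply nodup_In, in_app_or in Hj; destruct Hj as [Hj|Hj]; auto.
    rewrite <- E; apply in_map, Hi, in_map, Hj.
Qed.

Lemma NoDup_list_prod {I J} (L : list I) (M : list J) :
  NoDup L -> NoDup M -> NoDup (list_prod L M).
Proof.
  intros HL HM; induction HL as [|i L Hi HL IH]; simpl; [constructor|].
  apply NoDup_app; auto.
  - apply FinFun.Injective_map_NoDup; auto. intros x y E; congruence.
  - intros [x y] H H'. apply in_map_iff in H; destruct H as (z & E & _).
    apply in_prod_iff in H'. injection E as -> ->. tauto.
Qed.

(** A finite set of pairs containing a large rectangle P x Q misses the rectangle sum by at most the
    absolute mass outside it, which is at most A B minus the mass of the rectangle. *)
Lemma has_sum_prod {I J} (f : I -> C) (g : J -> C) a b A B :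
  has_sum f a -> has_sum g b -> has_norm_sum f A -> has_norm_sum g B ->
  has_sum (fun p => f (fst p) * g (snd p)) (a * b).
Proof.
  intros Hf Hg (HA & HA') (HB & HB') e He.
  assert (A0 : (0 <= A)%R) by (apply (HA nil); constructor).
  assert (B0 : (0 <= B)%R) by (apply (HB nil); constructor).
  pose proof (Cmod_ge_0 a) as a0; pose proof (Cmod_ge_0 b) as b0.
  (* The final error is at most d (A + B) + d (|a| + |b| + 1) = d K; the bound d <= 1 serves to
     estimate |y| by |b| + 1. *)
  set (K := (A + B + Cmod a + Cmod b + 1)%R).
  set (d := Rmin 1 (e / (4 * K))).
  assert (HK : (0 < K)%R) by (unfold K; lra).
  assert (Hd0 : (0 < d)%R)
    by (apply Rmin_pos; [lra | apply Rdiv_lt_0_compat; lra]).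
  assert (Hd1 : (d <= 1)%R) by apply Rmin_l.
  assert (HdK : (d * K <= e / 4)%R).
  { apply Rle_trans with (e / (4 * K) * K)%R.
    - apply Rmult_le_compat_r; [lra | apply Rmin_r].
    - right; field; lra. }
  destruct (Hf d Hd0) as (L1 & H1). destruct (HA' d Hd0) as (L1' & Hn1 & H1').
  destruct (Hg d Hd0) as (L2 & H2). destruct (HB' d Hd0) as (L2' & Hn2 & H2').
  destruct (incl_nodup_app L1 L1') as (Hn1' & Hi1 & Hi1').
  destruct (incl_nodup_app L2 L2') as (Hn2' & Hi2 & Hi2').
  specialize (H1 _ Hn1' Hi1). specialize (H2 _ Hn2' Hi2).
  pose proof (lsum_norm_incl f _ _ Hn1 Hi1') as M1.
  pose proof (lsum_norm_incl g _ _ Hn2 Hi2') as M2.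
  pose proof (HA _ Hn1') as N1. pose proof (HB _ Hn2') as N2.
  set (P := nodup _ (L1 ++ L1')) in *. set (Q := nodup _ (L2 ++ L2')) in *.
  exists (list_prod P Q). intros L Hn Hi.
  set (F := fun p : I * J => f (fst p) * g (snd p)).
  assert (HnPQ : NoDup (list_prod P Q)) by now apply NoDup_list_prod.
  pose proof (lsum_tail F _ _ HnPQ Hi) as T.
  assert (Tup : (lsum_norm F L <= A * B)%R).
  (* Every finite set of pairs lies in the product of its two projections. *)
  { set (P' := nodup classical_eq_dec (map fst L)). set (Q' := nodup classical_eq_dec (map snd L)).
    apply Rle_trans with (lsum_norm F (list_prod P' Q')).
    - apply lsum_norm_incl; auto. intros [i j] Hij.
      apply in_prod; apply nodup_In;
        [exact (in_map fst _ _ Hij) | exact (in_map snd _ _ Hij)].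
    - unfold F; rewrite lsum_norm_prod.
      apply Rmult_le_compat; try apply lsum_norm_ge0;
        [apply HA | apply HB]; apply NoDup_nodup. }
  unfold F in T at 2 4; rewrite lsum_prod, lsum_norm_prod in T.
  set (x := lsum f P) in *. set (y := lsum g Q) in *.
  set (X := lsum_norm f P) in *. set (Y := lsum_norm g Q) in *.
  assert (T1 : (Cmod (lsum F L - x * y) <= d * (A + B))%R).
  { assert (X0 : (0 <= X)%R) by apply lsum_norm_ge0.
    eapply Rle_trans; [exact T|]. nra. }
  assert (Hy : (Cmod y <= Cmod b + d)%R).
  { replace y with (b + (y - b)) by ring.
    eapply Rle_trans; [apply Cmod_triangle | lra]. }
  assert (T2 : (Cmod (x * y - a * b) <= d * (Cmod a + Cmod b + 1))%R).
  { replace (x * y - a * b) with ((x - a) * y + a * (y - b)) by ring.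
    eapply Rle_trans; [apply Cmod_triangle|]. rewrite !Cmod_mult.
    pose proof (Cmod_ge_0 (x - a)). pose proof (Cmod_ge_0 (y - b)).
    pose proof (Cmod_ge_0 y). nra. }
  replace (lsum F L - a * b) with ((lsum F L - x * y) + (x * y - a * b)) by ring.
  eapply Rle_lt_trans; [apply Cmod_triangle|].
  unfold K in HdK. nra.
Qed.

(** * Sums over the integers *)

(** The integers from -N to N - 1, listed so that a sum over [box N] consists of the N-th partial
    sums of the two series in [Zsum]. *)
Definition box (N : nat) : list Z :=
  map Z.of_nat (seq 0 N) ++ map (fun k => - Z.of_nat (S k))%Z (seq 0 N).

Lemma box_NoDup N : NoDup (box N).
Proof.
  apply NoDup_app.
  - apply FinFun.Injective_map_NoDup; [intros x y E; lia | apply seq_NoDup].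
  - apply FinFun.Injective_map_NoDup; [intros x y E; lia | apply seq_NoDup].
  - intros z H H'; apply in_map_iff in H; apply in_map_iff in H'.
    destruct H as (x & E & _); destruct H' as (y & E' & _); lia.
Qed.

Lemma in_box N z : (Z.abs z < Z.of_nat N)%Z -> In z (box N).
Proof.
  intros H; apply in_or_app. destruct (Z_le_gt_dec 0 z) as [Hz|Hz].
  - left; apply in_map_iff; exists (Z.to_nat z); split; [lia | apply in_seq; lia].
  - right; apply in_map_iff; exists (Z.to_nat (- z - 1)); split; [lia | apply in_seq; lia].
Qed.

Lemma incl_box (L : list Z) : exists N0, forall N, (N0 <= N)%nat -> incl L (box N).
Proof.
  induction L as [|z L (N0 & IH)]; [exists O; intros N _ x [] |].
  exists (Nat.max N0 (S (Z.abs_nat z))); intros N HN x [<-|Hx].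
  - apply in_box; lia.
  - apply IH; [lia | assumption].
Qed.

Definition exp_bounded (K : R) (f : Z -> C) : Prop :=
  forall n, (Cmod (f n) <= K * exp (- Rabs (IZR n)))%R.

(** A bound for the sum of exp(-|n|) over Z: each of the two halves contributes at most a full
    geometric series. *)
Definition geo_const : R := (2 / (1 - exp (-1)))%R.

Lemma exp_m1_lt_1 : (0 < exp (-1) < 1)%R.
Proof. split; [apply exp_pos | rewrite <- exp_0; apply exp_increasing; lra]. Qed.

Lemma geo_const_pos : (0 < geo_const)%R.
Proof. pose proof exp_m1_lt_1; apply Rdiv_lt_0_compat; lra. Qed.

Lemma exp_INR (k : nat) : exp (- INR k) = (exp (-1) ^ k)%R.
Proof.
  induction k as [|k IH]; [simpl; rewrite Ropp_0; apply exp_0|].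
  rewrite S_INR; simpl; rewrite <- IH, <- exp_plus; f_equal; ring.
Qed.

Lemma geo_partial (f : Z -> C) (g : nat -> Z) K N :
  (forall k, (Cmod (f (g k)) <= K * exp (-1) ^ k)%R) -> (0 <= K)%R ->
  (lsum_norm f (map g (seq 0 N)) <= K / (1 - exp (-1)))%R.
Proof.
  intros H HK; pose proof exp_m1_lt_1 as He.
  (* The exact finite geometric sum is what passes through the induction. *)
  enough (lsum_norm f (map g (seq 0 N)) <= K / (1 - exp (-1)) * (1 - exp (-1) ^ N))%R.
  { eapply Rle_trans; [eassumption|].
    assert (0 <= K / (1 - exp (-1)))%R by (apply Rdiv_le_0_compat; lra).
    assert (0 < exp (-1) ^ N)%R by (apply pow_lt; lra). nra. }
  induction N as [|N IH]; [simpl; lra|].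
  rewrite seq_S, map_app, lsum_norm_app; simpl. specialize (H N).
  apply Rle_trans with (K / (1 - exp (-1)) * (1 - exp (-1) ^ N) + K * exp (-1) ^ N)%R; [lra|].
  right; field; lra.
Qed.

Lemma exp_bounded_nonneg K f : exp_bounded K f -> (0 <= K)%R.
Proof.
  intros H; specialize (H 0%Z). rewrite Rabs_R0, Ropp_0, exp_0 in H.
  pose proof (Cmod_ge_0 (f 0%Z)); lra.
Qed.

Lemma exp_bounded_half K f : exp_bounded K f ->
  (forall k, (Cmod (f (Z.of_nat k)) <= K * exp (-1) ^ k)%R) /\
  (forall k, (Cmod (f (- Z.of_nat (S k))%Z) <= K * exp (-1) ^ k)%R).
Proof.
  intros H; pose proof (exp_bounded_nonneg K f H) as HK; split; intros k.
  - specialize (H (Z.of_nat k)). rewrite <- INR_IZR_INZ, Rabs_pos_eq in H by apply pos_INR.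
    now rewrite <- exp_INR.
  - specialize (H (- Z.of_nat (S k))%Z).
    rewrite opp_IZR, Rabs_Ropp, <- INR_IZR_INZ, Rabs_pos_eq, S_INR in H by apply pos_INR.
    rewrite <- exp_INR. eapply Rle_trans; [exact H|].
    apply Rmult_le_compat_l; auto. left; apply exp_increasing; lra.
Qed.

Lemma exp_bounded_norm K f L :
  exp_bounded K f -> NoDup L -> (lsum_norm f L <= K * geo_const)%R.
Proof.
  intros H Hn; pose proof (exp_bounded_nonneg K f H) as HK.
  destruct (incl_box L) as (N & HN).
  eapply Rle_trans; [apply (lsum_norm_incl f L (box N)); auto|].
  unfold box; rewrite lsum_norm_app.
  destruct (exp_bounded_half K f H) as (H1 & H2).
  pose proof (geo_partial f _ K N H1 HK) as P1.
  pose proof (geo_partial f _ K N H2 HK) as P2.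
  replace (K * geo_const)%R with (K / (1 - exp (-1)) + K / (1 - exp (-1)))%R; [lra|].
  unfold geo_const; pose proof exp_m1_lt_1; field; lra.
Qed.

Lemma bounded_has_norm_sum {I} (f : I -> C) M :
  (forall L, NoDup L -> (lsum_norm f L <= M)%R) -> exists A, has_norm_sum f A.
Proof.
  intros HM.
  destruct (completeness (fun x => exists L, NoDup L /\ x = lsum_norm f L)) as (A & HA & HA').
  - exists M; intros x (L & Hn & ->); auto.
  - exists 0%R, nil; split; [constructor | reflexivity].
  - exists A; split; [intros L Hn; apply HA; eauto|].
    intros e He. destruct (excluded_middle_informative
      (exists L0, NoDup L0 /\ (A - e < lsum_norm f L0)%R)) as [?|Hno]; auto.
    exfalso. enough (A <= A - e)%R by lra. apply HA'.
    intros x (L & Hn & ->). apply Rnot_lt_le; intros Hlt; apply Hno; eauto.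
Qed.

Lemma Re_lsum_seq (f : Z -> C) (g : nat -> Z) N :
  Re (lsum f (map g (seq 0 (S N)))) = sum_n (fun k => Re (f (g k))) N.
Proof.
  induction N as [|N IH].
  - simpl; rewrite sum_O; unfold Re; simpl; ring.
  - rewrite seq_S, map_app, lsum_app, sum_Sn, <- IH.
    unfold plus; simpl; unfold Re; simpl; ring.
Qed.

Lemma Im_lsum_seq (f : Z -> C) (g : nat -> Z) N :
  Im (lsum f (map g (seq 0 (S N)))) = sum_n (fun k => Im (f (g k))) N.
Proof.
  induction N as [|N IH].
  - simpl; rewrite sum_O; unfold Im; simpl; ring.
  - rewrite seq_S, map_app, lsum_app, sum_Sn, <- IH.
    unfold plus; simpl; unfold Im; simpl; ring.
Qed.

Lemma im_le_Cmod (z : C) : (Rabs (Im z) <= Cmod z)%R.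
Proof. eapply Rle_trans; [apply Rmax_r | apply Rmax_Cmod]. Qed.

Lemma geo_ex_series (a : nat -> R) K :
  (forall k, (Rabs (a k) <= K * exp (-1) ^ k)%R) -> ex_series a.
Proof.
  intros H; apply (ex_series_le (V := R_CompleteNormedModule) a (fun k => K * exp (-1) ^ k)%R).
  - exact H.
  - apply (ex_series_scal (V := R_NormedModule) K), ex_series_geom.
    pose proof exp_m1_lt_1. rewrite Rabs_pos_eq; lra.
Qed.

Lemma box_limit_half (f : Z -> C) (g : nat -> Z) K :
  (forall k, (Cmod (f (g k)) <= K * exp (-1) ^ k)%R) ->
  forall e : R, (0 < e)%R -> exists N0, forall N, (N0 <= N)%nat ->
    (Cmod (lsum f (map g (seq 0 N)) - CSeries (fun k => f (g k))) < e)%R.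
Proof.
  intros H e He.
  assert (HR : ex_series (fun k => Re (f (g k)))).
  { apply (geo_ex_series _ K); intros k; eapply Rle_trans; [apply re_le_Cmod | apply H]. }
  assert (HI : ex_series (fun k => Im (f (g k)))).
  { apply (geo_ex_series _ K); intros k; eapply Rle_trans; [apply im_le_Cmod | apply H]. }
  apply Series_correct in HR; apply Series_correct in HI.
  assert (He2 : (0 < e / 2)%R) by lra.
  destruct (HR _ (locally_ball _ (mkposreal _ He2))) as (N1 & H1).
  destruct (HI _ (locally_ball _ (mkposreal _ He2))) as (N2 & H2).
  exists (S (Nat.max N1 N2)); intros N HN.
  destruct N as [|N]; [lia|].
  specialize (H1 N ltac:(lia)); specialize (H2 N ltac:(lia)).
  rewrite <- Re_lsum_seq in H1; rewrite <- Im_lsum_seq in H2.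
  set (s := lsum f _) in *.
  change (Rabs (Re s - Series (fun k => Re (f (g k)))) < e / 2)%R in H1.
  change (Rabs (Im s - Series (fun k => Im (f (g k)))) < e / 2)%R in H2.
  unfold CSeries.
  set (x := Series _) in *. set (y := Series (fun k => Im _)) in *.
  replace (s - (x, y)) with (RtoC (Re s - x) + Ci * RtoC (Im s - y)).
  - eapply Rle_lt_trans; [apply Cmod_triangle|].
    rewrite Cmod_mult, Cmod_Ci, !Cmod_R. lra.
  - apply injective_projections; simpl; unfold Re, Im; ring.
Qed.

(** The box sums converge to [Zsum f], and a finite set containing a large box differs from it by at
    most the absolute mass outside the box. *)
Lemma has_sum_Zsum K (f : Z -> C) : exp_bounded K f -> has_sum f (Zsum f).
Proof.
  intros H e He. destruct (exp_bounded_half K f H) as (H1 & H2).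
  destruct (bounded_has_norm_sum f _ (fun L => exp_bounded_norm K f L H)) as (A & HA & HA').
  destruct (HA' (e/2)%R) as (L0 & Hn0 & HL0); [lra|].
  destruct (incl_box L0) as (N0 & HN0).
  destruct (box_limit_half f _ K H1 (e/4)%R) as (N1 & HN1); [lra|].
  destruct (box_limit_half f _ K H2 (e/4)%R) as (N2 & HN2); [lra|].
  set (N := Nat.max N0 (Nat.max N1 N2)).
  specialize (HN0 N ltac:(lia)); specialize (HN1 N ltac:(lia)); specialize (HN2 N ltac:(lia)).
  exists (box N). intros L Hn Hi.
  pose proof (lsum_tail f _ _ (box_NoDup N) Hi) as T.
  pose proof (lsum_norm_incl f _ _ Hn0 HN0). pose proof (HA L Hn).
  assert (B : (Cmod (lsum f (box N) - Zsum f) < e / 2)%R).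
  { unfold box, Zsum. rewrite lsum_app.
    match goal with |- context [Cmod (?x + ?y - (?u + ?v))] =>
      replace (x + y - (u + v)) with ((x - u) + (y - v)) by ring end.
    eapply Rle_lt_trans; [apply Cmod_triangle|]; lra. }
  replace (lsum f L - Zsum f) with ((lsum f L - lsum f (box N)) + (lsum f (box N) - Zsum f)) by ring.
  eapply Rle_lt_trans; [apply Cmod_triangle|]; lra.
Qed.

(** Decay beyond every exponential rate survives multiplication by n and leaves room for factors
    such as exp(3|n|). *)
Definition rapid (f : Z -> C) : Prop :=
  forall b : R, exists K : R, forall n, (Cmod (f n) <= K * exp (- b * Rabs (IZR n)))%R.

Lemma rapid_bounded f : rapid f -> exists K, exp_bounded K f.
Proof.
  intros H; destruct (H 1%R) as (K & HK); exists K; intros n.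
  replace (- Rabs (IZR n))%R with (- (1) * Rabs (IZR n))%R by ring. apply HK.
Qed.

Lemma has_sum_rapid f : rapid f -> has_sum f (Zsum f).
Proof. intros H; destruct (rapid_bounded f H) as (K & HK); exact (has_sum_Zsum K f HK). Qed.

Lemma has_norm_sum_rapid f : rapid f -> exists A, has_norm_sum f A.
Proof.
  intros H; destruct (rapid_bounded f H) as (K & HK).
  exact (bounded_has_norm_sum f _ (fun L => exp_bounded_norm K f L HK)).
Qed.

Lemma Zsum_bound K f : exp_bounded K f -> (Cmod (Zsum f) <= K * geo_const)%R.
Proof.
  intros H; apply (has_sum_norm_bound f); [exact (has_sum_Zsum K f H)|].
  intros L; now apply exp_bounded_norm.
Qed.

Lemma has_sum_rapid_prod f g : rapid f -> rapid g ->
  has_sum (fun p : Z * Z => f (fst p) * g (snd p)) (Zsum f * Zsum g).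
Proof.
  intros Hf Hg. destruct (has_norm_sum_rapid f Hf) as (A & HA).
  destruct (has_norm_sum_rapid g Hg) as (B & HB).
  apply (has_sum_prod f g _ _ A B); auto using has_sum_rapid.
Qed.

Lemma rapid_dominated f g : rapid f -> (forall n, (Cmod (g n) <= Cmod (f n))%R) -> rapid g.
Proof.
  intros H Hg b; destruct (H b) as (K & HK); exists K; intros n.
  eapply Rle_trans; [apply Hg | apply HK].
Qed.

Lemma rapid_scal c f : rapid f -> rapid (fun n => c * f n).
Proof.
  intros H b; destruct (H b) as (K & HK); exists (Cmod c * K)%R; intros n.
  rewrite Cmod_mult, Rmult_assoc. apply Rmult_le_compat_l; [apply Cmod_ge_0 | apply HK].
Qed.

Lemma rapid_plus f g : rapid f -> rapid g -> rapid (fun n => f n + g n).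
Proof.
  intros H H' b; destruct (H b) as (K & HK); destruct (H' b) as (K' & HK').
  exists (K + K')%R; intros n.
  eapply Rle_trans; [apply Cmod_triangle|]. specialize (HK n); specialize (HK' n); lra.
Qed.

(** On the generating function, the sum of f(n) exp(n s), this is differentiation in s; iterates
    summed over Z are its Taylor data at s = 0. *)
Definition mulZ (f : Z -> C) : Z -> C := fun n => IZR n * f n.

Lemma Rabs_le_exp x : (Rabs x <= exp (Rabs x))%R.
Proof. pose proof (exp_ineq1_le (Rabs x)); lra. Qed.

Lemma rapid_mulZ f : rapid f -> rapid (mulZ f).
Proof.
  intros H b; destruct (H (b + 1)%R) as (K & HK); exists K; intros n.
  unfold mulZ; rewrite Cmod_mult, Cmod_R.
  pose proof (Rabs_le_exp (IZR n)) as E. specialize (HK n).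
  replace (K * exp (- b * Rabs (IZR n)))%R
    with (exp (Rabs (IZR n)) * (K * exp (- (b + 1) * Rabs (IZR n))))%R.
  - apply Rmult_le_compat; auto using Rabs_pos, Cmod_ge_0.
  - rewrite (Rmult_comm K), <- Rmult_assoc, <- exp_plus, Rmult_comm; do 2 f_equal; ring.
Qed.

Lemma rapid_opp f : rapid f -> rapid (fun n => f (- n)%Z).
Proof.
  intros H b; destruct (H b) as (K & HK); exists K; intros n.
  specialize (HK (- n)%Z). rewrite opp_IZR, Rabs_Ropp in HK. exact HK.
Qed.

Lemma rapid_iter_mulZ k f : rapid f -> rapid (Nat.iter k mulZ f).
Proof. intros H; induction k; simpl; auto using rapid_mulZ. Qed.

Lemma iter_mulZ k f n : Nat.iter k mulZ f n = IZR n ^ k * f n.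
Proof.
  induction k as [|k IH]; simpl; [ring | unfold mulZ at 1; rewrite IH; ring].
Qed.

Lemma Zsum_plus f g : rapid f -> rapid g -> Zsum (fun n => f n + g n) = Zsum f + Zsum g.
Proof.
  intros Hf Hg; apply (has_sum_unique (fun n => f n + g n));
    [now apply has_sum_rapid, rapid_plus | apply has_sum_plus; now apply has_sum_rapid].
Qed.

Lemma Zsum_scal c f : rapid f -> Zsum (fun n => c * f n) = c * Zsum f.
Proof.
  intros Hf; apply (has_sum_unique (fun n => c * f n));
    [now apply has_sum_rapid, rapid_scal | apply has_sum_scal; now apply has_sum_rapid].
Qed.

Lemma Zsum_opp f : rapid f -> Zsum (fun n => f (- n)%Z) = Zsum f.
Proof.
  intros Hf; apply (has_sum_unique (fun n => f (- n)%Z));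
    [now apply has_sum_rapid, rapid_opp|].
  apply (has_sum_reindex Z.opp Z.opp f); [intros; lia | intros; lia | now apply has_sum_rapid].
Qed.

Lemma Zsum_ext f g : (forall n, f n = g n) -> Zsum f = Zsum g.
Proof. intros H; replace g with f; [auto | now apply functional_extensionality]. Qed.

(** * Rapidly decreasing families with vanishing moments *)

Definition null_moments (f : Z -> C) : Prop :=
  rapid f /\ forall k, Zsum (Nat.iter k mulZ f) = 0.

Lemma null_moments_plus f g :
  null_moments f -> null_moments g -> null_moments (fun n => f n + g n).
Proof.
  intros (Hf & Hf0) (Hg & Hg0); split; [now apply rapid_plus | intros k].
  rewrite (Zsum_ext _ (fun n => Nat.iter k mulZ f n + Nat.iter k mulZ g n))
    by (intros n; rewrite !iter_mulZ; ring).
  rewrite Zsum_plus, Hf0, Hg0 by now apply rapid_iter_mulZ. ring.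
Qed.

Lemma null_moments_scal c f : null_moments f -> null_moments (fun n => c * f n).
Proof.
  intros (Hf & Hf0); split; [now apply rapid_scal | intros k].
  rewrite (Zsum_ext _ (fun n => c * Nat.iter k mulZ f n))
    by (intros n; rewrite !iter_mulZ; ring).
  rewrite Zsum_scal, Hf0 by now apply rapid_iter_mulZ. ring.
Qed.

Lemma null_moments_mulZ f : null_moments f -> null_moments (mulZ f).
Proof.
  intros (Hf & Hf0); split; [now apply rapid_mulZ | intros k].
  rewrite <- Nat.iter_succ_r. apply Hf0.
Qed.

(** Multiplies f by the product of 1 - ((n - m)/k)^2 for k = 1, ..., N, a partial product of sin(pi
    x)/(pi x) at x = n - m. It is a polynomial in n, equal to 1 at m and 0 at the other integers
    within distance N of m. *)
Fixpoint damp (m : Z) (f : Z -> C) (N : nat) : Z -> C :=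
  match N with
  | O => f
  | S N' => fun n => RtoC (1 - (IZR (n - m) / INR N) ^ 2) * damp m f N' n
  end.

Lemma null_moments_damp m f N : null_moments f -> null_moments (damp m f N).
Proof.
  intros Hf; induction N as [|N IH]; [exact Hf|].
  set (g := damp m f N) in IH. set (c := (/ INR (S N))%R).
  (* Expanding the new factor in powers of n shows that it preserves vanishing moments. *)
  assert (E : damp m f (S N) = fun n =>
      (g n + RtoC (- c ^ 2) * mulZ (mulZ g) n)
      + (RtoC (2 * IZR m * c ^ 2) * mulZ g n + RtoC (- IZR m ^ 2 * c ^ 2) * g n)).
  { apply functional_extensionality; intros n; cbn [damp]; fold g.
    unfold mulZ, Rdiv; fold c. rewrite minus_IZR.
    rewrite !RtoC_minus, !RtoC_pow, !RtoC_mult, !RtoC_opp, !RtoC_minus, !RtoC_pow. ring. }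
  rewrite E.
  apply null_moments_plus; apply null_moments_plus; auto;
    apply null_moments_scal; auto using null_moments_mulZ.
Qed.

Lemma damp_center m f N : damp m f N m = f m.
Proof.
  induction N as [|N IH]; cbn [damp]; [reflexivity|].
  rewrite IH, Z.sub_diag. replace (1 - (0 / INR (S N)) ^ 2)%R with 1%R; [ring|].
  unfold Rdiv; ring.
Qed.

Lemma damp_zero m f N n : n <> m -> (Z.abs (n - m) <= Z.of_nat N)%Z -> damp m f N n = 0.
Proof.
  intros Hn; induction N as [|N IH]; intros H; [lia|]. cbn [damp].
  destruct (Z_le_gt_dec (Z.abs (n - m)) (Z.of_nat N)) as [Hle|Hgt].
  - rewrite IH by assumption; ring.
  - assert (E : Z.abs (n - m) = Z.of_nat (S N)) by lia.
    replace ((IZR (n - m) / INR (S N)) ^ 2)%R with ((IZR (Z.abs (n - m)) / INR (S N)) ^ 2)%R.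
    + rewrite E, <- INR_IZR_INZ. replace (INR (S N) / INR (S N))%R with 1%R.
      * replace (1 - 1 ^ 2)%R with 0%R by ring. ring.
      * field. apply not_0_INR; lia.
    + rewrite abs_IZR. unfold Rdiv; rewrite !Rpow_mult_distr, pow2_abs. reflexivity.
Qed.

(** Within distance N the left side is 0. Farther out y = |n - m|/k is at least 1 for every k <= N,
    so each factor satisfies |1 - y^2| <= y^2. *)
Lemma damp_bound m f N n : n <> m ->
  (Cmod (damp m f N n) <= (IZR (Z.abs (n - m)) ^ N / INR (fact N)) ^ 2 * Cmod (f n))%R.
Proof.
  intros Hn; induction N as [|N IH].
  - simpl. replace (1 / 1 * (1 / 1 * 1))%R with 1%R by field. lra.
  - destruct (Z_le_gt_dec (Z.abs (n - m)) (Z.of_nat (S N))) as [Hle|Hgt].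
    + rewrite damp_zero, Cmod_0 by assumption.
      apply Rmult_le_pos; [apply pow2_ge_0 | apply Cmod_ge_0].
    + cbn [damp]. rewrite Cmod_mult, Cmod_R.
      set (r := IZR (Z.abs (n - m))) in *.
      assert (HN : (0 < INR (S N))%R) by (apply lt_0_INR; lia).
      assert (Hr : (INR (S N) <= r)%R).
      { unfold r; rewrite INR_IZR_INZ; apply IZR_le; lia. }
      replace ((IZR (n - m) / INR (S N)) ^ 2)%R with ((r / INR (S N)) ^ 2)%R
        by (unfold r; rewrite abs_IZR; unfold Rdiv; rewrite !Rpow_mult_distr, pow2_abs;
            reflexivity).
      set (y := (r / INR (S N))%R).
      assert (Hy : (1 <= y)%R).
      { unfold y; apply Rmult_le_reg_r with (INR (S N)); [assumption|].
        unfold Rdiv; rewrite Rmult_assoc, Rinv_l by lra. lra. }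
      replace ((r ^ S N / INR (fact (S N))) ^ 2)%R with (y ^ 2 * (r ^ N / INR (fact N)) ^ 2)%R.
      * rewrite Rmult_assoc. apply Rmult_le_compat; auto using Rabs_pos, Cmod_ge_0.
        apply Rabs_le; nra.
      * unfold y. rewrite fact_simpl, mult_INR. simpl pow. field.
        split; [apply INR_fact_neq_0 | change (INR (S N) <> 0%R); lra].
Qed.

Lemma pow_fact_le_exp r N : (0 <= r)%R -> (r ^ N / INR (fact N) <= exp r)%R.
Proof.
  intros Hr; eapply Rle_trans; [|apply (exp_ge_taylor r N Hr)].
  destruct N as [|N]; [simpl; lra|]. simpl sum_f_R0.
  assert (0 <= sum_f_R0 (fun k => r ^ k / INR (fact k)) N)%R.
  { apply cond_pos_sum; intros k; apply Rdiv_le_0_compat;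
      [now apply pow_le | apply INR_fact_lt_0]. }
  simpl in *; lra.
Qed.

Lemma le_exp_arg x y : (x <= y)%R -> (exp x <= exp y)%R.
Proof. intros [H | ->]; [left; now apply exp_increasing | lra]. Qed.

(* Only a far tail survives the damping, and there the damping factor is at most
   exp(2|n - m|), which the decay of f absorbs. *)
Lemma null_moments_zero f m : null_moments f -> f m = 0.
Proof.
  (* With r = |n - m| > N the damping factor is at most exp(2r) <= exp(3r - N), and r <= |n| + |m|.
     Decay at rate 4 thus leaves exp(-|n|), a constant exp(3|m|) and the gain exp(-N). *)
  intros Hf; destruct (proj1 Hf 4%R) as (K & HK).
  set (A := (K * exp (3 * Rabs (IZR m)))%R).
  assert (HB : forall N, (Cmod (f m) <= A * geo_const * exp (-1) ^ N)%R).
  { intros N.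
    destruct (null_moments_damp m f N Hf) as (Hr & Hg0).
    set (g := damp m f N) in *. specialize (Hg0 O); simpl in Hg0.
    set (h := fun n => if Z.eq_dec n m then RtoC 0 else g n).
    set (d := fun n => if Z.eq_dec n m then g m else RtoC 0).
    assert (Hh : exp_bounded (A * exp (-1) ^ N) h).
    { intros n; unfold h; destruct (Z.eq_dec n m) as [->|Hn].
      - rewrite Cmod_0. assert (0 <= K)%R.
        { specialize (HK 0%Z). rewrite Rabs_R0, Rmult_0_r, exp_0 in HK.
          pose proof (Cmod_ge_0 (f 0%Z)); lra. }
        apply Rmult_le_pos; [|left; apply exp_pos].
        apply Rmult_le_pos; [|apply pow_le; left; apply exp_pos].
        apply Rmult_le_pos; [assumption | left; apply exp_pos].
      - set (r := IZR (Z.abs (n - m))).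
        assert (Hr0 : (0 <= r)%R) by (apply IZR_le; lia).
        assert (Hrm : (r <= Rabs (IZR n) + Rabs (IZR m))%R).
        { unfold r; rewrite abs_IZR, minus_IZR.
          eapply Rle_trans; [apply Rabs_triang|]. rewrite Rabs_Ropp; lra. }
        specialize (HK n).
        assert (HKp : (0 <= K * exp (- (4) * Rabs (IZR n)))%R)
          by (pose proof (Cmod_ge_0 (f n)); lra).
        apply Rle_trans with (exp (- INR N) * exp (3 * r) * (K * exp (- (4) * Rabs (IZR n))))%R.
        + destruct (Z_le_gt_dec (Z.abs (n - m)) (Z.of_nat N)) as [Hle|Hgt].
          * unfold g; rewrite damp_zero, Cmod_0 by assumption.
            apply Rmult_le_pos; [|assumption].
            apply Rmult_le_pos; left; apply exp_pos.
          * eapply Rle_trans; [apply (damp_bound m f N n Hn)|]. fold r.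
            apply Rmult_le_compat; auto using pow2_ge_0, Cmod_ge_0.
            assert (HNr : (INR N <= r)%R)
              by (unfold r; rewrite INR_IZR_INZ; apply IZR_le; lia).
            apply Rle_trans with (exp r ^ 2)%R.
            -- apply pow_incr; split; [|now apply pow_fact_le_exp].
               apply Rdiv_le_0_compat; [now apply pow_le | apply INR_fact_lt_0].
            -- simpl; rewrite Rmult_1_r, <- !exp_plus. apply le_exp_arg; lra.
        + assert (K0 : (0 <= K)%R).
          { apply Rmult_le_reg_r with (exp (- (4) * Rabs (IZR n))); [apply exp_pos | lra]. }
          unfold A. rewrite <- exp_INR.
          replace (exp (- INR N) * exp (3 * r) * (K * exp (- (4) * Rabs (IZR n))))%R
            with (K * (exp (- INR N) * exp (3 * r) * exp (- (4) * Rabs (IZR n))))%R by ring.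
          replace (K * exp (3 * Rabs (IZR m)) * exp (- INR N) * exp (- Rabs (IZR n)))%R
            with (K * (exp (3 * Rabs (IZR m)) * exp (- INR N) * exp (- Rabs (IZR n))))%R by ring.
          apply Rmult_le_compat_l; [assumption|]. rewrite <- !exp_plus.
          apply le_exp_arg; lra. }
    assert (Hs : has_sum g (f m + Zsum h)).
    { apply (has_sum_ext (fun n => d n + h n)).
      - intros n; unfold d, h; destruct (Z.eq_dec n m) as [->|]; ring.
      - apply has_sum_plus; [|exact (has_sum_Zsum _ h Hh)].
        replace (f m) with (d m).
        + apply has_sum_single. intros j Hj; unfold d; now destruct (Z.eq_dec j m).
        + unfold d; destruct (Z.eq_dec m m); [apply damp_center | easy]. }
    (* The damped family still has total 0 and its value at m is f m, so f m is minus the tail. *)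
    assert (E : f m = - Zsum h).
    { pose proof (has_sum_unique g _ _ (has_sum_rapid g Hr) Hs) as E.
      rewrite Hg0 in E. apply Ceq_minus. rewrite E. ring. }
    rewrite E, Cmod_opp. eapply Rle_trans; [apply (Zsum_bound _ h Hh)|]. lra. }
  apply Cmod_small_eq; intros e He. pose proof geo_const_pos as G.
  pose proof exp_m1_lt_1 as X.
  set (D := (A * geo_const)%R) in *.
  assert (HD : (0 <= D)%R) by (specialize (HB O); simpl in HB; pose proof (Cmod_ge_0 (f m)); lra).
  destruct (pow_lt_1_zero (exp (-1)) ltac:(rewrite Rabs_pos_eq; lra) (e / (D + 1))%R)
    as (N & HN); [apply Rdiv_lt_0_compat; lra|].
  specialize (HN N (le_n N)). specialize (HB N).
  rewrite Rabs_pos_eq in HN by (apply pow_le; lra).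
  eapply Rle_lt_trans; [exact HB|].
  apply Rle_lt_trans with (D * (e / (D + 1)))%R; [apply Rmult_le_compat_l; lra|].
  apply Rmult_lt_reg_r with (D + 1)%R; [lra|]. field_simplify; [nra | lra].
Qed.

(** * Bilinear moment sums *)

(* The value of the double sum of (n+m)^k mu(n) nu(m). *)
Fixpoint bil (k : nat) (mu nu : Z -> C) : C :=
  match k with
  | O => Zsum mu * Zsum nu
  | S k' => bil k' (mulZ mu) nu + bil k' mu (mulZ nu)
  end.

Lemma has_sum_bil k mu nu : rapid mu -> rapid nu ->
  has_sum (fun p : Z * Z => IZR (fst p + snd p) ^ k * (mu (fst p) * nu (snd p))) (bil k mu nu).
Proof.
  revert mu nu; induction k as [|k IH]; intros mu nu Hm Hn; simpl.
  - eapply has_sum_ext; [|now apply has_sum_rapid_prod]. intros p; simpl; ring.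
  - eapply has_sum_ext;
      [|apply has_sum_plus; apply IH; auto using rapid_mulZ].
    intros [n m]; unfold mulZ; simpl fst; simpl snd. rewrite plus_IZR, RtoC_plus. ring.
Qed.

Lemma bil_sym k mu nu : bil k mu nu = bil k nu mu.
Proof.
  revert mu nu; induction k as [|k IH]; intros mu nu; simpl; [ring|].
  rewrite (IH (mulZ mu)), (IH mu). ring.
Qed.

Lemma mulZ_plus f g : mulZ (fun n => f n + g n) = fun n => mulZ f n + mulZ g n.
Proof. apply functional_extensionality; intros n; unfold mulZ; ring. Qed.

Lemma mulZ_scal c f : mulZ (fun n => c * f n) = fun n => c * mulZ f n.
Proof. apply functional_extensionality; intros n; unfold mulZ; ring. Qed.

Lemma bil_plus k f g nu : rapid f -> rapid g ->
  bil k (fun n => f n + g n) nu = bil k f nu + bil k g nu.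
Proof.
  revert f g nu; induction k as [|k IH]; intros f g nu Hf Hg; simpl.
  - rewrite Zsum_plus by assumption; ring.
  - rewrite mulZ_plus, !IH by auto using rapid_mulZ. ring.
Qed.

Lemma bil_scal k c f nu : rapid f -> bil k (fun n => c * f n) nu = c * bil k f nu.
Proof.
  revert f nu; induction k as [|k IH]; intros f nu Hf; simpl.
  - rewrite Zsum_scal by assumption; ring.
  - rewrite mulZ_scal, !IH by auto using rapid_mulZ. ring.
Qed.

(** Leibniz rule: if F vanishes to order k at 0, the k-th derivative of F G there is F^(k)(0)
    G(0). *)
Lemma bil_low_moments k f nu : (forall j, (j < k)%nat -> Zsum (Nat.iter j mulZ f) = 0) ->
  bil k f nu = Zsum (Nat.iter k mulZ f) * Zsum nu.
Proof.
  revert f nu; induction k as [|k IH]; intros f nu H; simpl; [ring|].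
  rewrite (IH (mulZ f)), (IH f).
  - rewrite (H k), <- Nat.iter_succ_r by lia. simpl; ring.
  - intros j Hj; apply H; lia.
  - intros j Hj; rewrite <- Nat.iter_succ_r; apply H; lia.
Qed.

(* In terms of the generating functions F and G of mu and nu, this is the
   differential equation F'G - FG' = c FG read off on Taylor coefficients. *)
Definition tilted (c : C) (mu nu : Z -> C) : Prop :=
  forall k, bil k (mulZ mu) nu - bil k mu (mulZ nu) - c * bil k mu nu = 0.

Lemma tilted_comb c a b mu mu' nu : rapid mu -> rapid mu' ->
  tilted c mu nu -> tilted c mu' nu -> tilted c (fun n => a * mu n + b * mu' n) nu.
Proof.
  intros Hm Hm' H H' k. specialize (H k); specialize (H' k).
  assert (Ha : rapid (fun n => a * mu n)) by now apply rapid_scal.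
  assert (Hb : rapid (fun n => b * mu' n)) by now apply rapid_scal.
  rewrite mulZ_plus, !mulZ_scal, !bil_plus, !bil_scal
    by auto using rapid_mulZ, rapid_scal.
  transitivity (a * (bil k (mulZ mu) nu - bil k mu (mulZ nu) - c * bil k mu nu)
    + b * (bil k (mulZ mu') nu - bil k mu' (mulZ nu) - c * bil k mu' nu)); [ring|].
  rewrite H, H'; ring.
Qed.

Lemma tilted_refl nu : tilted 0 nu nu.
Proof. intros k; rewrite (bil_sym k (mulZ nu) nu); ring. Qed.

Lemma tilted_sym mu nu : tilted 0 mu nu -> tilted 0 nu mu.
Proof.
  intros H k; specialize (H k).
  rewrite (bil_sym k (mulZ nu)), (bil_sym k nu (mulZ mu)), (bil_sym k nu mu).
  transitivity (- (bil k (mulZ mu) nu - bil k mu (mulZ nu) - 0 * bil k mu nu)); [ring|].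
  rewrite H; ring.
Qed.

Lemma Cmult_integral (x y : C) : x * y = 0 -> x = 0 \/ y = 0.
Proof.
  intros H. destruct (excluded_middle_informative (x = 0)); auto.
  destruct (excluded_middle_informative (y = 0)); auto.
  exfalso; now apply (Cmult_neq_0 x y).
Qed.

(** A first-order linear equation with initial value 0: once the moments of [d] up to order k
    vanish, the relation at k leaves only the moment of order k + 1 times the nonzero total of [nu].
    All moments then vanish, hence [d] does. *)
Lemma tilted_null c d nu : rapid d ->
  tilted c d nu -> Zsum nu <> 0 -> Zsum d = 0 -> forall n, d n = 0.
Proof.
  intros Hd HT Hnu H0 n; apply null_moments_zero; split; [exact Hd|].
  enough (H : forall k j, (j <= k)%nat -> Zsum (Nat.iter j mulZ d) = 0) by (intros k; now apply (H k k)).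
  induction k as [|k IH]; intros j Hj; [now replace j with O by lia|].
  destruct (Nat.eq_dec j (S k)) as [->|]; [|apply IH; lia].
  specialize (HT k).
  rewrite !bil_low_moments in HT.
  - rewrite <- Nat.iter_succ_r in HT. simpl in HT.
    rewrite (IH k (le_n k)) in HT.
    destruct (Cmult_integral (Zsum (Nat.iter (S k) mulZ d)) (Zsum nu)) as [E|E]; auto.
    + simpl. rewrite <- HT. ring.
    + contradiction.
  - intros i Hi; apply IH; lia.
  - intros i Hi; apply IH; lia.
  - intros i Hi; rewrite <- Nat.iter_succ_r; apply IH; lia.
Qed.

(** Both families solve the same linear equation, so their combination with total 0 vanishes
    identically. *)
Lemma tilted_unique c mu mu' nu : rapid mu -> rapid mu' ->
  tilted c mu nu -> tilted c mu' nu -> Zsum nu <> 0 ->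
  forall n, Zsum mu' * mu n = Zsum mu * mu' n.
Proof.
  intros Hm Hm' H H' Hnu n. apply Ceq_minus.
  rewrite <- (tilted_null c (fun n => Zsum mu' * mu n + - Zsum mu * mu' n) nu) with (n := n);
    auto using rapid_plus, rapid_scal, tilted_comb.
  - ring.
  - rewrite Zsum_plus, !Zsum_scal by auto using rapid_scal. ring.
Qed.

(** * Theta identities from rotating the lattice of indices *)

(** Extension by zero, rather than reindexing by n/2, keeps Z as index set and commutes with
    [mulZ]. *)
Definition parity_part (b : bool) (f : Z -> C) : Z -> C :=
  fun n => if Bool.eqb (Z.odd n) b then f n else 0.

Lemma rapid_parity_part b f : rapid f -> rapid (parity_part b f).
Proof.
  intros H; apply (rapid_dominated f); auto. intros n; unfold parity_part.
  destruct (Bool.eqb _ _); [lra | rewrite Cmod_0; apply Cmod_ge_0].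
Qed.

Lemma parity_part_mulZ b f : parity_part b (mulZ f) = mulZ (parity_part b f).
Proof.
  apply functional_extensionality; intros n; unfold parity_part, mulZ.
  destruct (Bool.eqb _ _); ring.
Qed.

Lemma parity_part_iter_mulZ b k f :
  parity_part b (Nat.iter k mulZ f) = Nat.iter k mulZ (parity_part b f).
Proof. induction k; simpl; [reflexivity | now rewrite parity_part_mulZ, IHk]. Qed.

(** The map (n, m) -> (n + m + p, n - m) is a bijection onto the pairs (s, d) with s + d of parity
    p; splitting by the parity of s gives the two terms. The case p = 0 serves products of theta
    values, p = 1 products of the odd theta function, whose indices are half-odd. *)
Lemma has_sum_rotate (p : bool) k f g : rapid f -> rapid g ->
  has_sum (fun nm : Z * Z =>
      let s := (fst nm + snd nm + Z.b2z p)%Z in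
      let d := (fst nm - snd nm)%Z in
      IZR (s + d) ^ k * (f s * g d))
    (bil k (parity_part false f) (parity_part p g)
     + bil k (parity_part true f) (parity_part (negb p) g)).
Proof.
  intros Hf Hg.
  set (F := fun sd : Z * Z =>
    IZR (fst sd + snd sd) ^ k * (parity_part false f (fst sd) * parity_part p g (snd sd))
    + IZR (fst sd + snd sd) ^ k * (parity_part true f (fst sd) * parity_part (negb p) g (snd sd))).
  assert (HF : has_sum F (bil k (parity_part false f) (parity_part p g)
                          + bil k (parity_part true f) (parity_part (negb p) g)))
    by (apply has_sum_plus; apply has_sum_bil; auto using rapid_parity_part).
  apply (has_sum_reindex
    (fun nm => (fst nm + snd nm + Z.b2z p, fst nm - snd nm)%Z)
    (fun sd => ((fst sd + snd sd - Z.b2z p) / 2, (fst sd - snd sd - Z.b2z p) / 2)%Z)) in HF.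
  - eapply has_sum_ext; [|exact HF]. intros [n m]; unfold F, parity_part; cbn [fst snd].
    assert (Z.odd (n + m + Z.b2z p) = xorb (Z.odd (n - m)) p) as ->.
    { rewrite !Z.odd_add, Z.odd_sub. now destruct p, (Z.odd n), (Z.odd m). }
    destruct p, (Z.odd (n - m)); simpl Bool.eqb; cbv iota; ring.
  - intros [n m]; cbn [fst snd]; f_equal; generalize (Z.b2z p); intros e;
      Z.to_euclidean_division_equations; lia.
  - intros [s d] H; unfold F, parity_part; cbn [fst snd] in *.
    (* Off the image the parities are incompatible, so each of the two products contains a vanishing
       parity part. *)
    assert (Hp : Z.odd s <> xorb (Z.odd d) p).
    { intros E; apply H. pose proof (Zdiv2_odd_eqn s) as Es. pose proof (Zdiv2_odd_eqn d) as Ed.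
      rewrite E in Es. generalize dependent (Z.div2 s). generalize dependent (Z.div2 d).
      clear. intros d' Ed s' Es.
      destruct p, (Z.odd d); cbn [xorb Z.b2z] in *; f_equal;
        Z.to_euclidean_division_equations; lia. }
    destruct p, (Z.odd s), (Z.odd d); simpl in Hp |- *; try ring; now destruct Hp.
Qed.

(** * The complex exponential and the Gaussian weights *)

Lemma Cexp_plus z w : Cexp (z + w) = Cexp z * Cexp w.
Proof.
  unfold Cexp, Cmult; simpl. unfold Re, Im; simpl.
  rewrite exp_plus, cos_plus, sin_plus. f_equal; ring.
Qed.

Lemma Cmod_Cexp z : Cmod (Cexp z) = exp (Re z).
Proof.
  unfold Cexp, Cmod; cbn [fst snd].
  replace ((exp (Re z) * cos (Im z)) ^ 2 + (exp (Re z) * sin (Im z)) ^ 2)%R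
    with ((exp (Re z)) ^ 2 * (Rsqr (sin (Im z)) + Rsqr (cos (Im z))))%R
    by (unfold Rsqr; ring).
  rewrite sin2_cos2, Rmult_1_r. apply sqrt_pow2. left; apply exp_pos.
Qed.

Lemma bfe_plus z w : bfe (z + w) = bfe z * bfe w.
Proof. unfold bfe; rewrite <- Cexp_plus; f_equal; ring. Qed.

Lemma bfe_neq_0 z : bfe z <> 0.
Proof. apply Cmod_gt_0; unfold bfe; rewrite Cmod_Cexp; apply exp_pos. Qed.

Lemma Cmod_gauss_weight u B n :
  Cmod (gauss_weight u B n) = exp (2 * PI * (- (1 / 2) * Re B * IZR n ^ 2 + IZR n * Re u)).
Proof.
  unfold gauss_weight, bfe; rewrite Cmod_Cexp; f_equal.
  destruct u as [u1 u2], B as [b1 b2]. unfold Re; simpl. field.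
Qed.

Lemma rapid_gauss_weight u B : H1 B -> rapid (gauss_weight u B).
Proof.
  intros HB b. unfold H1 in HB.
  set (c := (2 * PI * Rabs (Re u) + Rabs b)%R). pose proof PI_RGT_0 as HPI.
  exists (exp (c ^ 2 / (4 * PI * Re B))); intros n.
  rewrite Cmod_gauss_weight, <- exp_plus. apply le_exp_arg.
  set (x := Rabs (IZR n)).
  assert (Hx : (IZR n ^ 2 = x ^ 2)%R) by (unfold x; now rewrite pow2_abs).
  assert (Hx0 : (0 <= x)%R) by apply Rabs_pos.
  assert (Hu : (IZR n * Re u <= x * Rabs (Re u))%R)
    by (eapply Rle_trans; [apply Rle_abs | rewrite Rabs_mult; unfold x; lra]).
  assert (Hb : (b * x <= Rabs b * x)%R) by (apply Rmult_le_compat_r; auto using Rle_abs).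
  set (a := (PI * Re B)%R).
  assert (Ha : (0 < a)%R) by (apply Rmult_lt_0_compat; lra).
  (* Completing the square. *)
  assert (Hsq : (c * x - a * x ^ 2 <= c ^ 2 / (4 * a))%R).
  { apply Rmult_le_reg_r with (4 * a)%R; [lra|].
    replace (c ^ 2 / (4 * a) * (4 * a))%R with (c ^ 2)%R by (field; lra).
    pose proof (pow2_ge_0 (c - 2 * a * x)). nra. }
  replace (c ^ 2 / (4 * PI * Re B))%R with (c ^ 2 / (4 * a))%R by (unfold a; f_equal; ring).
  rewrite Hx. unfold a, c in Hsq. unfold a, c. nra.
Qed.

Lemma gauss_weight_opp u B n : gauss_weight (- u) B n = gauss_weight u B (- n).
Proof. unfold gauss_weight; f_equal. rewrite opp_IZR, RtoC_opp; ring. Qed.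

(** The parallelogram law n^2 + m^2 = ((n + m)^2 + (n - m)^2)/2 is what halves [B]. *)
Lemma gauss_weight_mult p q B n m :
  gauss_weight p B n * gauss_weight q B m =
  gauss_weight ((p + q) / 2) (B / 2) (n + m) * gauss_weight ((p - q) / 2) (B / 2) (n - m).
Proof.
  unfold gauss_weight; rewrite <- !bfe_plus; f_equal.
  rewrite plus_IZR, minus_IZR, RtoC_plus, RtoC_minus. field.
Qed.

(** * The odd theta function and the two parity halves *)

Definition sgn (n : Z) : C := if Z.odd n then - (1) else 1.

Lemma Cmod_sgn n : Cmod (sgn n) = 1%R.
Proof. unfold sgn; destruct (Z.odd n); [apply Cmod_m1 | apply Cmod_1]. Qed.

(* Up to an exponential factor, the sum over n is theta translated by the
   half-period (B + i)/2; it is an odd function of z. *)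
Definition odd_weight (z B : C) (n : Z) : C :=
  sgn n * bfe (- (1 / 8) * B * IZR (2 * n + 1) ^ 2 + IZR (2 * n + 1) / 2 * z).

Definition odd_moment (k : nat) (z B : C) : C :=
  Zsum (fun n => IZR (2 * n + 1) ^ k * odd_weight z B n).

Lemma rapid_odd_weight k z B : H1 B -> rapid (fun n => IZR (2 * n + 1) ^ k * odd_weight z B n).
Proof.
  intros HB; induction k as [|k IH].
  - apply (rapid_dominated (fun n => bfe (z / 2 - B / 8) * gauss_weight (z - B / 2) B n)).
    + now apply rapid_scal, rapid_gauss_weight.
    + intros n; right; simpl Cpow. rewrite Cmult_1_l. unfold odd_weight.
      rewrite Cmod_mult, Cmod_sgn, Rmult_1_l. unfold gauss_weight; rewrite <- bfe_plus.
      do 2 f_equal. rewrite plus_IZR, mult_IZR, RtoC_plus, RtoC_mult. field.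
  - replace (fun n => IZR (2 * n + 1) ^ S k * odd_weight z B n)
      with (fun n => 2 * mulZ (fun n => IZR (2 * n + 1) ^ k * odd_weight z B n) n
                     + IZR (2 * n + 1) ^ k * odd_weight z B n).
    + apply rapid_plus; auto. now apply rapid_scal, rapid_mulZ.
    + apply functional_extensionality; intros n; unfold mulZ; rewrite Cpow_S.
      rewrite plus_IZR, mult_IZR, RtoC_plus, RtoC_mult. ring.
Qed.

(** The parallelogram law for n + 1/2 and m + 1/2, whose sum is n + m + 1 and whose difference is n
    - m; the shift by 1 produces the minus sign. *)
Lemma odd_weight_mult x y B n m :
  odd_weight (x + y) B n * odd_weight (x - y) B m =
  - (sgn (n + m + 1) * gauss_weight x (B / 2) (n + m + 1) * gauss_weight y (B / 2) (n - m)).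
Proof.
  unfold odd_weight, gauss_weight.
  replace (sgn (n + m + 1)) with (- (sgn n * sgn m)).
  - match goal with |- ?a * bfe ?e * (?b * bfe ?e') = _ =>
      transitivity (a * b * (bfe e * bfe e')); [ring|] end.
    match goal with |- _ = - (- ?c * bfe ?e * bfe ?e') =>
      transitivity (c * (bfe e * bfe e')); [|ring] end.
    f_equal. rewrite <- !bfe_plus; f_equal.
    repeat rewrite ?plus_IZR, ?minus_IZR, ?mult_IZR, ?RtoC_plus, ?RtoC_minus, ?RtoC_mult. field.
  - unfold sgn; rewrite !Z.odd_add. destruct (Z.odd n), (Z.odd m); simpl; ring.
Qed.

Lemma parity_part_sgn b f :
  parity_part b (fun n => sgn n * f n) =
  fun n => (if b then - (1) else 1) * parity_part b f n.
Proof.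
  apply functional_extensionality; intros n; unfold parity_part, sgn.
  destruct b, (Z.odd n); simpl; ring.
Qed.

Lemma rapid_sgn f : rapid f -> rapid (fun n => sgn n * f n).
Proof.
  intros H; apply (rapid_dominated f); auto. intros n; rewrite Cmod_mult, Cmod_sgn; lra.
Qed.

Lemma H1_half B : H1 B -> H1 (B / 2).
Proof.
  unfold H1; intros HB. replace (Re (B / 2)) with (Re B / 2)%R; [lra|].
  destruct B as [b1 b2]; unfold Re; simpl. field.
Qed.

(** The even part sums to theta(2x, 2B), a theta function of second order; the odd part gives its
    companion. Their sums are the A_0 and A_1 of the overview. *)
Definition half_weight (B : C) (b : bool) (x : C) : Z -> C := parity_part b (gauss_weight x (B / 2)).

Definition half_sum (B : C) (b : bool) (k : nat) (x : C) : C :=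
  Zsum (Nat.iter k mulZ (half_weight B b x)).

Lemma rapid_half_weight B b x : H1 B -> rapid (half_weight B b x).
Proof. intros HB; now apply rapid_parity_part, rapid_gauss_weight, H1_half. Qed.

(** In the rotated sum with p = 1 the indices s and d have opposite parities, and the sign [sgn] of
    s turns the sum of the two terms into a difference. *)
Lemma half_addition B x y : H1 B ->
  half_sum B false 0 x * half_sum B true 0 y - half_sum B true 0 x * half_sum B false 0 y
  = - (odd_moment 0 (x + y) B * odd_moment 0 (x - y) B).
Proof.
  intros HB. pose proof (fun x => rapid_gauss_weight x _ (H1_half B HB)) as Ha.
  pose proof (has_sum_rotate true 0 _ _ (rapid_sgn _ (Ha x)) (Ha y)) as H.
  pose proof (has_sum_scal (- (1)) _ _ (has_sum_rapid_prod _ _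
    (rapid_odd_weight 0 (x + y) B HB) (rapid_odd_weight 0 (x - y) B HB))) as H'.
  eapply has_sum_ext in H; [pose proof (has_sum_unique _ _ _ H H') as E|].
  - unfold odd_moment. simpl in E. rewrite !parity_part_sgn in E.
    rewrite !Zsum_scal in E by auto using rapid_parity_part.
    unfold half_sum, half_weight; simpl.
    match goal with |- _ = - ?r => transitivity (- (1) * r); [|ring] end.
    rewrite <- E; ring.
  - intros [n m]; cbn [fst snd Cpow]. unfold Z.b2z.
    rewrite !Cmult_1_l, odd_weight_mult. ring.
Qed.

(* The Wronskian of the even and odd halves, together with its higher analogues. *)
Lemma half_wronskian B k u : H1 B ->
  2 * (bil k (mulZ (half_weight B false u)) (half_weight B true u)
       - bil k (half_weight B false u) (mulZ (half_weight B true u)))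
  = - (odd_moment k (2 * u) B * odd_moment 1 0 B).
Proof.
  intros HB. pose proof (fun x => rapid_gauss_weight x _ (H1_half B HB)) as Ha.
  pose proof (has_sum_rotate true k _ _ (rapid_mulZ _ (rapid_sgn _ (Ha u))) (Ha u)) as Hl.
  pose proof (has_sum_rotate true k _ _ (rapid_sgn _ (Ha u)) (rapid_mulZ _ (Ha u))) as Hr.
  (* Here s + d = 2n + 1 and s - d = 2m + 1, so the difference of the two sums separates into an odd
     moment of order k at 2u and one of order 1 at 0. *)
  pose proof (has_sum_plus _ _ _ _ Hl (has_sum_scal (- (1)) _ _ Hr)) as H.
  pose proof (has_sum_scal (- (1)) _ _ (has_sum_rapid_prod _ _
    (rapid_odd_weight k (2 * u) B HB) (rapid_odd_weight 1 0 B HB))) as H'.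
  eapply has_sum_ext in H; [pose proof (has_sum_unique _ _ _ H H') as E|].
  - unfold odd_moment, half_weight. rewrite !parity_part_mulZ, !parity_part_sgn, !mulZ_scal in E.
    simpl negb in E. cbv iota in E.
    rewrite !bil_scal in E by auto using rapid_mulZ, rapid_parity_part.
    match goal with |- _ = - ?r => transitivity (- (1) * r); [|ring] end.
    rewrite <- E. rewrite (bil_sym k (mulZ (parity_part true _))),
      (bil_sym k (parity_part true _)). ring.
  - intros [n m]; cbn [fst snd Cpow]. unfold mulZ, Z.b2z.
    replace (n + m + 1 + (n - m))%Z with (2 * n + 1)%Z by ring.
    replace (2 * u) with (u + u) by ring. replace (RtoC 0) with (u - u) by ring.
    pose proof (odd_weight_mult u u B n m) as O.
    match type of O with ?l = _ =>
      transitivity (- (1) * (IZR (2 * n + 1) ^ k * IZR (2 * m + 1) * l)); [|ring] end.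
    rewrite O. 
    repeat rewrite ?plus_IZR, ?minus_IZR, ?mult_IZR, ?RtoC_plus, ?RtoC_minus, ?RtoC_mult. ring.
Qed.

(** After rotation the powers of n + m and of n - m fall on different factors, so the double sum
    separates within each parity class. *)
Lemma has_sum_theta_product B p q k j : H1 B ->
  has_sum (fun nm : Z * Z => IZR (fst nm + snd nm) ^ k * IZR (fst nm - snd nm) ^ j *
             (gauss_weight p B (fst nm) * gauss_weight q B (snd nm)))
    (half_sum B false k ((p + q) / 2) * half_sum B false j ((p - q) / 2)
     + half_sum B true k ((p + q) / 2) * half_sum B true j ((p - q) / 2)).
Proof.
  intros HB. pose proof (fun x => rapid_gauss_weight x _ (H1_half B HB)) as Ha.
  pose proof (has_sum_rotate false 0 _ _
    (rapid_iter_mulZ k _ (Ha ((p + q) / 2))) (rapid_iter_mulZ j _ (Ha ((p - q) / 2)))) as H.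
  simpl bil in H. rewrite !parity_part_iter_mulZ in H.
  eapply has_sum_ext; [|exact H]. intros [n m]; cbn [fst snd Cpow Z.b2z].
  rewrite !iter_mulZ, gauss_weight_mult, Z.add_0_r. ring.
Qed.

Definition gauss_moment (k : nat) (u B : C) : C := Zsum (Nat.iter k mulZ (gauss_weight u B)).

Lemma theta_bil B p q k : H1 B ->
  bil k (gauss_weight p B) (gauss_weight q B) =
  half_sum B false k ((p + q) / 2) * half_sum B false 0 ((p - q) / 2)
  + half_sum B true k ((p + q) / 2) * half_sum B true 0 ((p - q) / 2).
Proof.
  intros HB. eapply has_sum_unique; [apply has_sum_bil; now apply rapid_gauss_weight|].
  eapply has_sum_ext; [|now apply has_sum_theta_product]. intros [n m]; simpl; ring.
Qed.

Lemma theta_bil_diff B p q k : H1 B ->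
  bil k (mulZ (gauss_weight p B)) (gauss_weight q B)
  - bil k (gauss_weight p B) (mulZ (gauss_weight q B)) =
  half_sum B false k ((p + q) / 2) * half_sum B false 1 ((p - q) / 2)
  + half_sum B true k ((p + q) / 2) * half_sum B true 1 ((p - q) / 2).
Proof.
  intros HB. pose proof (fun x => rapid_gauss_weight x _ HB) as Ha.
  eapply has_sum_unique; [|now apply has_sum_theta_product].
  match goal with |- has_sum _ (?x - ?y) => replace (x - y) with (x + - (1) * y) by ring end.
  eapply has_sum_ext; [|apply has_sum_plus; [|apply has_sum_scal];
    apply has_sum_bil; auto using rapid_mulZ].
  intros [n m]; unfold mulZ; cbn [fst snd Cpow]. rewrite minus_IZR, RtoC_minus; ring.
Qed.

(** The factor (n - m)^2 yields the variance: for k = 0 the left side is 2 theta(u)^2 times the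
    variance of X_u. *)
Lemma theta_bil_diff2 B u k : H1 B ->
  bil k (mulZ (mulZ (gauss_weight u B))) (gauss_weight u B)
  - 2 * bil k (mulZ (gauss_weight u B)) (mulZ (gauss_weight u B))
  + bil k (gauss_weight u B) (mulZ (mulZ (gauss_weight u B))) =
  half_sum B false k u * half_sum B false 2 0 + half_sum B true k u * half_sum B true 2 0.
Proof.
  intros HB. pose proof (rapid_gauss_weight u _ HB) as Ha.
  pose proof (has_sum_theta_product B u u k 2 HB) as H.
  replace ((u + u) / 2) with u in H by field. replace ((u - u) / 2) with (RtoC 0) in H by field.
  eapply has_sum_unique; [|exact H].
  match goal with |- has_sum _ (?x - RtoC 2 * ?y + ?z) =>
    replace (x - 2 * y + z) with (x + (- (2) * y + z)) by ring end.
  eapply has_sum_ext; [|apply has_sum_plus; [|apply has_sum_plus; [apply has_sum_scal|]];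
    apply has_sum_bil; auto using rapid_mulZ].
  intros [n m]; unfold mulZ; cbn [fst snd Cpow]. rewrite minus_IZR, RtoC_minus; ring.
Qed.

Lemma theta_bil_self B u k : H1 B ->
  bil k (gauss_weight u B) (gauss_weight u B) =
  half_sum B false k u * half_sum B false 0 0 + half_sum B true k u * half_sum B true 0 0.
Proof.
  intros HB; rewrite theta_bil by assumption.
  replace ((u + u) / 2) with u by field. now replace ((u - u) / 2) with (RtoC 0) by field.
Qed.

Lemma half_wronskian0 B u : H1 B ->
  2 * (half_sum B false 1 u * half_sum B true 0 u - half_sum B false 0 u * half_sum B true 1 u)
  = - (odd_moment 0 (2 * u) B * odd_moment 1 0 B).
Proof. intros HB; rewrite <- half_wronskian by assumption; reflexivity. Qed.

(** The case k = 1, u = 0 of the Wronskian identity, where the products of first moments cancel. It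
    is the determinant of the Moebius map giving the variance. *)
Lemma half_determinant B : H1 B ->
  2 * (half_sum B false 2 0 * half_sum B true 0 0 - half_sum B false 0 0 * half_sum B true 2 0)
  = - (odd_moment 1 0 B * odd_moment 1 0 B).
Proof.
  intros HB. pose proof (half_wronskian B 1 0 HB) as H. rewrite Cmult_0_r in H.
  rewrite <- H. unfold half_sum; simpl. ring.
Qed.

Lemma two_neq_0 : RtoC 2 <> 0.
Proof. intros E; apply RtoC_inj in E; lra. Qed.

(* Otherwise the even and odd halves of theta would have vanishing Wronskian, hence
   be proportional, although their supports are disjoint. *)
Lemma odd_moment_neq_0 B u : H1 B -> theta u B <> 0 -> odd_moment 1 0 B <> 0.
Proof.
  intros HB Ht E0.
  pose proof (rapid_half_weight B false u HB) as Rm.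
  pose proof (rapid_half_weight B true u HB) as Rn.
  set (mu := half_weight B false u) in *. set (nu := half_weight B true u) in *.
  assert (T : tilted 0 mu nu).
  { intros k. pose proof (half_wronskian B k u HB) as H. fold mu nu in H.
    rewrite E0, Cmult_0_r in H.
    destruct (Cmult_integral 2 (bil k (mulZ mu) nu - bil k mu (mulZ nu))) as [E|E].
    - rewrite H; ring.
    - now apply two_neq_0 in E.
    - rewrite E; ring. }
  (* A half with nonzero total forces the other to be proportional to it; evaluating at 1 or at 0,
     where exactly one half is nonzero, is contradictory. If both totals vanish, so does
     theta(u)^2. *)
  destruct (excluded_middle_informative (Zsum nu = 0)) as [En|En].
  - destruct (excluded_middle_informative (Zsum mu = 0)) as [Em|Em].
    + pose proof (theta_bil_self B u 0 HB) as H.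
      unfold half_sum in H; simpl in H. fold mu nu in H. rewrite En, Em in H.
      destruct (Cmult_integral (theta u B) (theta u B)); try contradiction.
      unfold theta; rewrite H; ring.
    + pose proof (tilted_unique 0 nu mu mu Rn Rm (tilted_sym _ _ T) (tilted_refl _) Em 1%Z) as H.
      rewrite En, Cmult_0_l in H. apply Cmult_integral in H. destruct H as [H|H]; auto.
      apply (bfe_neq_0 _ H).
  - pose proof (tilted_unique 0 mu nu nu Rm Rn T (tilted_refl _) En 0%Z) as H.
    change (nu 0%Z) with (RtoC 0) in H. rewrite Cmult_0_r in H.
    apply Cmult_integral in H. destruct H as [H|H]; auto.
    apply (bfe_neq_0 _ H).
Qed.

Lemma tilted_of_odd_zero B p q : H1 B -> theta p B <> 0 -> theta q B <> 0 ->
  odd_moment 0 (p - q) B = 0 -> exists c, tilted c (gauss_weight p B) (gauss_weight q B).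
Proof.
  intros HB Hp Hq H0.
  pose proof (theta_bil B p q 0 HB) as E.
  pose proof (half_wronskian0 B ((p - q) / 2) HB) as W.
  replace (2 * ((p - q) / 2)) with (p - q) in W by field.
  rewrite H0, Cmult_0_l in W.
  set (v := (p - q) / 2) in *.
  set (a0 := half_sum B false 0 v) in *. set (a1 := half_sum B true 0 v) in *.
  set (b0 := half_sum B false 1 v) in *. set (b1 := half_sum B true 1 v) in *.
  assert (W' : b0 * a1 - a0 * b1 = 0).
  { destruct (Cmult_integral 2 (b0 * a1 - a0 * b1)) as [Z|Z]; auto.
    - rewrite W; ring.
    - now apply two_neq_0 in Z. }
  assert (Hc : exists c, b0 = c * a0 /\ b1 = c * a1).
  (* The vectors (a0, a1) and (b0, b1) are parallel, and (a0, a1) is nonzero since it occurs in the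
     expansion of theta(p) theta(q). *)
  { destruct (excluded_middle_informative (a0 = 0)) as [Z0|Z0].
    - destruct (excluded_middle_informative (a1 = 0)) as [Z1|Z1].
      + exfalso. apply (Cmult_neq_0 (theta p B) (theta q B)); auto.
        change (theta p B * theta q B) with (bil 0 (gauss_weight p B) (gauss_weight q B)).
        rewrite E, Z0, Z1; ring.
      + exists (b1 / a1); split; [|now field].
        destruct (Cmult_integral b0 a1) as [Z|Z]; try contradiction.
        * rewrite Z0 in W'. rewrite <- W'; ring.
        * rewrite Z, Z0; ring.
    - exists (b0 / a0); split; [now field|].
      transitivity ((b0 * a1 - (b0 * a1 - a0 * b1)) / a0); [now field|].
      rewrite W'; now field. }
  destruct Hc as (c & Hb0 & Hb1). exists c; intros k.
  rewrite theta_bil_diff, theta_bil by assumption. fold v a0 a1 b0 b1.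
  rewrite Hb0, Hb1; ring.
Qed.

(** * Moments of discrete Gaussians and the first claim *)

Lemma gauss_moment_opp k u B : H1 B ->
  gauss_moment k (- u) B = (- (1)) ^ k * gauss_moment k u B.
Proof.
  intros HB; unfold gauss_moment.
  pose proof (rapid_iter_mulZ k _ (rapid_gauss_weight u B HB)) as Hr.
  rewrite <- (Zsum_opp _ Hr), <- Zsum_scal by now apply rapid_opp.
  apply Zsum_ext; intros n. rewrite !iter_mulZ, gauss_weight_opp, opp_IZR, RtoC_opp.
  rewrite Cmult_assoc, <- Cpow_mult_l. f_equal; f_equal; ring.
Qed.

Lemma gauss_moment_eq k u B : H1 B -> theta u B <> 0 ->
  gauss_moment k u B = theta u B * moment k u B.
Proof.
  intros HB Ht; unfold moment.
  rewrite (Zsum_ext _ (fun n => / theta u B * Nat.iter k mulZ (gauss_weight u B) n)).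
  - rewrite Zsum_scal by (now apply rapid_iter_mulZ, rapid_gauss_weight).
    unfold gauss_moment. now field.
  - intros n; unfold p_theta; rewrite iter_mulZ; now field.
Qed.

(* The variance is a Moebius function of the ratio of the two half sums. *)
Lemma odd_zero_of_moments B u u' : H1 B -> theta u B <> 0 -> theta u' B <> 0 ->
  same_moments 2 u B u' B -> odd_moment 0 (u + u') B * odd_moment 0 (u - u') B = 0.
Proof.
  intros HB Hu Hu' Hm.
  pose proof (odd_moment_neq_0 B u HB Hu) as Hodd.
  pose proof (half_determinant B HB) as D.
  pose proof (Hm 1%nat ltac:(lia)) as m1. pose proof (Hm 2%nat ltac:(lia)) as m2.
  pose proof (gauss_moment_eq 1 u B HB Hu) as M1. pose proof (gauss_moment_eq 2 u B HB Hu) as M2.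
  pose proof (gauss_moment_eq 1 u' B HB Hu') as M1'.
  pose proof (gauss_moment_eq 2 u' B HB Hu') as M2'.
  rewrite <- m1 in M1'; rewrite <- m2 in M2'.
  pose proof (theta_bil_self B u 0 HB) as S. pose proof (theta_bil_self B u' 0 HB) as S'.
  pose proof (theta_bil_diff2 B u 0 HB) as V. pose proof (theta_bil_diff2 B u' 0 HB) as V'.
  cbn [bil] in S, S', V, V'.
  change (Zsum (mulZ (mulZ (gauss_weight u B)))) with (gauss_moment 2 u B) in V.
  change (Zsum (mulZ (gauss_weight u B))) with (gauss_moment 1 u B) in V.
  change (Zsum (mulZ (mulZ (gauss_weight u' B)))) with (gauss_moment 2 u' B) in V'.
  change (Zsum (mulZ (gauss_weight u' B))) with (gauss_moment 1 u' B) in V'.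
  change (Zsum (gauss_weight u B)) with (theta u B) in S, V.
  change (Zsum (gauss_weight u' B)) with (theta u' B) in S', V'.
  rewrite M1, M2 in V; rewrite M1', M2' in V'.
  pose proof (half_addition B u u' HB) as A.
  set (x := theta u B) in *. set (x' := theta u' B) in *.
  set (a0 := half_sum B false 0 u) in *. set (a1 := half_sum B true 0 u) in *.
  set (a0' := half_sum B false 0 u') in *. set (a1' := half_sum B true 0 u') in *.
  set (d0 := half_sum B false 0 0) in *. set (d1 := half_sum B true 0 0) in *.
  set (c0 := half_sum B false 2 0) in *. set (c1 := half_sum B true 2 0) in *.
  assert (D0 : c0 * d1 - d0 * c1 <> 0).
  { intros Z; rewrite Z in D. apply (Cmult_neq_0 _ _ Hodd Hodd).
    transitivity (- - (odd_moment 1 0 B * odd_moment 1 0 B)); [ring|]. rewrite <- D; ring. }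
  (* The vectors (a0, a1)/x^2 and (a0', a1')/x'^2 satisfy the same two linear equations, from
     theta^2 and from the variance. The determinant is nonzero, so their difference, here cleared of
     denominators, is 0. *)
  set (e0 := a0 * x' ^ 2 - a0' * x ^ 2). set (e1 := a1 * x' ^ 2 - a1' * x ^ 2).
  assert (L1 : e0 * d0 + e1 * d1 = 0).
  { transitivity (x' ^ 2 * (a0 * d0 + a1 * d1) - x ^ 2 * (a0' * d0 + a1' * d1));
      [unfold e0, e1; ring|]. rewrite <- S, <- S'; ring. }
  assert (L2 : e0 * c0 + e1 * c1 = 0).
  { transitivity (x' ^ 2 * (a0 * c0 + a1 * c1) - x ^ 2 * (a0' * c0 + a1' * c1));
      [unfold e0, e1; ring|]. rewrite <- V, <- V'; ring. }
  assert (E0 : e0 = 0).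
  { destruct (Cmult_integral e0 (c0 * d1 - d0 * c1)) as [Z|Z]; [|exact Z|contradiction].
    transitivity (d1 * (e0 * c0 + e1 * c1) - c1 * (e0 * d0 + e1 * d1)); [ring|].
    rewrite L1, L2; ring. }
  assert (E1 : e1 = 0).
  { destruct (Cmult_integral e1 (c0 * d1 - d0 * c1)) as [Z|Z]; [|exact Z|contradiction].
    transitivity (c0 * (e0 * d0 + e1 * d1) - d0 * (e0 * c0 + e1 * c1)); [ring|].
    rewrite L1, L2; ring. }
  destruct (Cmult_integral (x' ^ 2) (a0 * a1' - a1 * a0')) as [Z|Z].
  - transitivity (e0 * a1' - e1 * a0'); [unfold e0, e1; ring|]. rewrite E0, E1; ring.
  - now apply (Cpow_nz _ 2) in Hu'.
  - transitivity (- - (odd_moment 0 (u + u') B * odd_moment 0 (u - u') B)); [ring|].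
    rewrite <- A, Z; ring.
Qed.

Lemma odd_zero_of_third_cumulant B u : H1 B -> theta u B <> 0 ->
  moment 3 u B - 3 * moment 1 u B * moment 2 u B + 2 * moment 1 u B ^ 3 = 0 ->
  odd_moment 0 (2 * u) B = 0.
Proof.
  intros HB Hu K.
  pose proof (odd_moment_neq_0 B u HB Hu) as Hodd.
  pose proof (half_determinant B HB) as D. pose proof (half_wronskian0 B u HB) as W.
  pose proof (gauss_moment_eq 1 u B HB Hu) as M1. pose proof (gauss_moment_eq 2 u B HB Hu) as M2.
  pose proof (gauss_moment_eq 3 u B HB Hu) as M3.
  pose proof (theta_bil_self B u 0 HB) as S. pose proof (theta_bil_self B u 1 HB) as S'.
  pose proof (theta_bil_diff2 B u 0 HB) as V. pose proof (theta_bil_diff2 B u 1 HB) as V'.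
  cbn [bil] in S, S', V, V'.
  change (Zsum (mulZ (mulZ (mulZ (gauss_weight u B))))) with (gauss_moment 3 u B) in V, V'.
  change (Zsum (mulZ (mulZ (gauss_weight u B)))) with (gauss_moment 2 u B) in V, V'.
  change (Zsum (mulZ (gauss_weight u B))) with (gauss_moment 1 u B) in S', V, V'.
  change (Zsum (gauss_weight u B)) with (theta u B) in S, S', V, V'.
  rewrite M1, M2 in V; rewrite M1, M2, M3 in V'; rewrite M1 in S'.
  set (x := theta u B) in *.
  set (m1 := moment 1 u B) in *. set (m2 := moment 2 u B) in *. set (m3 := moment 3 u B) in *.
  set (a0 := half_sum B false 0 u) in *. set (a1 := half_sum B true 0 u) in *.
  set (b0 := half_sum B false 1 u) in *. set (b1 := half_sum B true 1 u) in *.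
  set (d0 := half_sum B false 0 0) in *. set (d1 := half_sum B true 0 0) in *.
  set (c0 := half_sum B false 2 0) in *. set (c1 := half_sum B true 2 0) in *.
  set (o := odd_moment 1 0 B) in *.
  (* Quotient rule for the variance (a.c)/(a.d): by the Binet-Cauchy identity the numerator of the
     derivative is the Wronskian times the determinant, and it is also the third cumulant times 2
     x^4. *)
  assert (P : (2 * (b0 * a1 - a0 * b1)) * (2 * (c0 * d1 - d0 * c1)) = 0).
  { transitivity (4 * ((b0 * c0 + b1 * c1) * (a0 * d0 + a1 * d1)
                       - (a0 * c0 + a1 * c1) * (b0 * d0 + b1 * d1))); [ring|].
    rewrite <- S, <- S', <- V, <- V'.
    transitivity (8 * x ^ 4 * (m3 - 3 * m1 * m2 + 2 * m1 ^ 3)); [ring|].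
    rewrite K; ring. }
  rewrite W, D in P.
  destruct (Cmult_integral (odd_moment 0 (2 * u) B) (o * (o * o))) as [Z|Z]; auto.
  - rewrite <- P; ring.
  - exfalso; revert Z; apply Cmult_neq_0, Cmult_neq_0; assumption.
Qed.

Lemma tilted_moment_1 c p q B : H1 B -> theta p B <> 0 -> theta q B <> 0 ->
  tilted c (gauss_weight p B) (gauss_weight q B) -> c = moment 1 p B - moment 1 q B.
Proof.
  intros HB Hp Hq H. specialize (H 0%nat); cbn [bil] in H.
  change (gauss_moment 1 p B * theta q B - theta p B * gauss_moment 1 q B
          - c * (theta p B * theta q B) = 0) in H.
  rewrite !gauss_moment_eq in H by assumption.
  destruct (Cmult_integral (theta p B * theta q B) (moment 1 p B - moment 1 q B - c)) as [Z|Z].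
  - rewrite <- H; ring.
  - exfalso; revert Z; now apply Cmult_neq_0.
  - transitivity (c + 0); [ring|]. rewrite <- Z; ring.
Qed.

Lemma same_distribution_of_weights u u' B : theta u B <> 0 -> theta u' B <> 0 ->
  (forall n, theta u' B * gauss_weight u B n = theta u B * gauss_weight u' B n) ->
  same_distribution u B u' B.
Proof.
  intros Hu Hu' H n; unfold p_theta.
  transitivity (theta u' B * gauss_weight u B n / (theta u B * theta u' B)); [now field|].
  rewrite H; now field.
Qed.

Lemma three_moments_determine B u u' : H1 B -> theta u B <> 0 -> theta u' B <> 0 ->
  same_moments 3 u B u' B -> same_distribution u B u' B.
Proof.
  intros HB Hu Hu' Hm.
  pose proof (fun x => rapid_gauss_weight x B HB) as Ha.
  pose proof (Hm 1%nat ltac:(lia)) as m1. pose proof (Hm 2%nat ltac:(lia)) as m2.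
  pose proof (Hm 3%nat ltac:(lia)) as m3.
  assert (Hm2 : same_moments 2 u B u' B) by (intros k Hk; apply Hm; lia).
  apply same_distribution_of_weights; auto.
  destruct (Cmult_integral _ _ (odd_zero_of_moments B u u' HB Hu Hu' Hm2)) as [Z|Z].
  - assert (O : forall k, gauss_moment k (- u) B = theta u B * ((- (1)) ^ k * moment k u B)).
    { intros k; rewrite gauss_moment_opp, gauss_moment_eq by assumption; ring. }
    assert (Eo : theta (- u) B = theta u B).
    { pose proof (gauss_moment_opp 0 u B HB) as E; unfold gauss_moment in E; simpl in E.
      unfold theta; rewrite E; ring. }
    assert (Hou : theta (- u) B <> 0) by now rewrite Eo.
    assert (mo : moment 1 (- u) B = - moment 1 u B).
    { pose proof (gauss_moment_eq 1 (- u) B HB Hou) as E. rewrite O, Eo in E.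
      transitivity (theta u B * moment 1 (- u) B / theta u B); [now field|].
      rewrite <- E; simpl; now field. }
    destruct (tilted_of_odd_zero B u' (- u) HB Hu' Hou) as (c & T).
    { now replace (u' - - u) with (u + u') by ring. }
    pose proof (tilted_moment_1 c u' (- u) B HB Hu' Hou T) as Ec.
    (* A tilt preserves all cumulants beyond the first, while reflection negates the third. At order
       2 the relation therefore reads 2 theta(u) theta(u') times the third cumulant equals 0. *)
    assert (K : moment 3 u B - 3 * moment 1 u B * moment 2 u B + 2 * moment 1 u B ^ 3 = 0).
    { pose proof (T 2%nat) as T2; cbn [bil] in T2.
      change (Zsum (mulZ (mulZ (mulZ (gauss_weight u' B))))) with (gauss_moment 3 u' B) in T2.
      change (Zsum (mulZ (mulZ (gauss_weight u' B)))) with (gauss_moment 2 u' B) in T2.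
      change (Zsum (mulZ (gauss_weight u' B))) with (gauss_moment 1 u' B) in T2.
      change (Zsum (mulZ (mulZ (mulZ (gauss_weight (- u) B))))) with (gauss_moment 3 (- u) B) in T2.
      change (Zsum (mulZ (mulZ (gauss_weight (- u) B)))) with (gauss_moment 2 (- u) B) in T2.
      change (Zsum (mulZ (gauss_weight (- u) B))) with (gauss_moment 1 (- u) B) in T2.
      change (Zsum (gauss_weight u' B)) with (theta u' B) in T2.
      change (Zsum (gauss_weight (- u) B)) with (theta (- u) B) in T2.
      rewrite Ec, mo, !O, Eo, !(fun k => gauss_moment_eq k u' B HB Hu'), <- m1, <- m2, <- m3 in T2.
      simpl Cpow in T2.
      match goal with |- ?e = RtoC 0 =>
        destruct (Cmult_integral (2 * (theta u B * theta u' B)) e) as [Y|Y]; auto end.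
      - rewrite <- T2; ring.
      - exfalso; revert Y; apply Cmult_neq_0; [apply two_neq_0 | now apply Cmult_neq_0]. }
    pose proof (odd_zero_of_third_cumulant B u HB Hu K) as Z2.
    (* Since X_u and X_u' have the same mean, both are tilts of X_{-u} at the same rate, and
       uniqueness applies. *)
    destruct (tilted_of_odd_zero B u (- u) HB Hu Hou) as (c' & T').
    { now replace (u - - u) with (2 * u) by ring. }
    pose proof (tilted_moment_1 c' u (- u) B HB Hu Hou T') as Ec'.
    rewrite m1, <- Ec in Ec'; subst c'.
    exact (tilted_unique c _ _ _ (Ha u) (Ha u') T' T Hou).
  - destruct (tilted_of_odd_zero B u u' HB Hu Hu' Z) as (c & T).
    pose proof (tilted_moment_1 c u u' B HB Hu Hu' T) as Ec.
    assert (E0 : c = 0) by (rewrite Ec, m1; ring). rewrite E0 in T.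
    exact (tilted_unique 0 _ _ _ (Ha u) (Ha u') T (tilted_refl _) Hu').
Qed.

(** * The centred family in the nome q *)

Definition nome_weight (q : C) (n : Z) : C := q ^ (Z.abs_nat n * Z.abs_nat n).

Definition nome_sum (j : nat) (q : C) : C := Zsum (Nat.iter j mulZ (nome_weight q)).

Lemma bfe_nat_mult k z : bfe (INR k * z) = bfe z ^ k.
Proof.
  induction k as [|k IH].
  - replace (INR 0 * z) with (RtoC 0) by (simpl; ring). unfold bfe.
    replace (2 * PI * 0) with (RtoC 0) by ring.
    unfold Cexp; simpl. rewrite exp_0, cos_0, sin_0. apply injective_projections; simpl; ring.
  - rewrite S_INR, RtoC_plus, Cpow_S, <- IH, <- bfe_plus. f_equal; ring.
Qed.

Lemma INR_abs_sqr n : INR (Z.abs_nat n * Z.abs_nat n) = (IZR n * IZR n)%R.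
Proof.
  rewrite mult_INR, INR_IZR_INZ, Zabs2Nat.id_abs, abs_IZR, <- Rabs_mult.
  apply Rabs_pos_eq, Rle_0_sqr.
Qed.

Lemma gauss_weight_nome B n : gauss_weight 0 B n = nome_weight (bfe (- (1 / 2) * B)) n.
Proof.
  unfold gauss_weight, nome_weight. rewrite <- bfe_nat_mult. f_equal.
  rewrite INR_abs_sqr, RtoC_mult. ring.
Qed.

Lemma Cmod_pow_le q rho k : (Cmod q <= rho)%R -> (Cmod (q ^ k) <= rho ^ k)%R.
Proof. intros H; rewrite Cmod_pow; apply pow_incr; split; [apply Cmod_ge_0 | exact H]. Qed.

Lemma rapid_nome q rho : (0 < rho < 1)%R -> (Cmod q <= rho)%R -> rapid (nome_weight q).
Proof.
  intros Hr Hq.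
  (* The real parameter whose nome exp(-pi b) equals rho. *)
  set (b := RtoC (- ln rho / PI)).
  pose proof PI_RGT_0 as HPI.
  assert (Hb : H1 b).
  { unfold H1, b; simpl. apply Rdiv_lt_0_compat; [|lra].
    rewrite <- ln_1. enough (ln rho < ln 1)%R by (rewrite ln_1 in *; lra).
    apply ln_increasing; lra. }
  apply (rapid_dominated (gauss_weight 0 b)); [now apply rapid_gauss_weight|].
  intros n. rewrite gauss_weight_nome. unfold nome_weight. rewrite !Cmod_pow.
  apply pow_incr; split; [apply Cmod_ge_0|].
  unfold bfe. rewrite Cmod_Cexp.
  replace (Re (2 * PI * (- (1 / 2) * b))) with (ln rho); [rewrite exp_ln; lra|].
  unfold b, Re; simpl. field. lra.
Qed.

(** The mean value bound k rho^(k-1), written as k rho^k / rho to avoid truncated subtraction at k =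
    0. *)
Lemma pow_diff_bound q q' rho k : (0 < rho)%R -> (Cmod q <= rho)%R -> (Cmod q' <= rho)%R ->
  (Cmod (q ^ k - q' ^ k) <= INR k * rho ^ k / rho * Cmod (q - q'))%R.
Proof.
  intros Hr Hq Hq'; induction k as [|k IH].
  - simpl. replace (1 - 1) with (RtoC 0) by ring. rewrite Cmod_0.
    unfold Rdiv; rewrite !Rmult_0_l; lra.
  - replace (q ^ S k - q' ^ S k) with (q * (q ^ k - q' ^ k) + (q - q') * q' ^ k)
      by (simpl; ring).
    eapply Rle_trans; [apply Cmod_triangle|]. rewrite !Cmod_mult.
    pose proof (Cmod_pow_le q' rho k Hq') as Hp.
    replace (INR (S k) * rho ^ S k / rho * Cmod (q - q'))%R
      with (rho * (INR k * rho ^ k / rho * Cmod (q - q')) + Cmod (q - q') * rho ^ k)%R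
      by (rewrite S_INR; simpl; field; lra).
    apply Rplus_le_compat; apply Rmult_le_compat; auto using Cmod_ge_0; lra.
Qed.

Lemma nome_sum_lipschitz j rho : (0 < rho < 1)%R -> exists L, forall q q',
  (Cmod q <= rho)%R -> (Cmod q' <= rho)%R ->
  (Cmod (nome_sum j q - nome_sum j q') <= L * Cmod (q - q'))%R.
Proof.
  intros Hr.
  assert (Hrc : (Cmod (RtoC rho) <= rho)%R) by (rewrite Cmod_R, Rabs_pos_eq; lra).
  (* Differentiating q^(n^2) in q costs a factor n^2, hence the two extra powers of n. *)
  destruct (rapid_bounded _ (rapid_iter_mulZ (2 + j) _ (rapid_nome rho rho Hr Hrc))) as (K & HK).
  exists (K / rho * geo_const)%R; intros q q' Hq Hq'.
  pose proof (rapid_iter_mulZ j _ (rapid_nome q rho Hr Hq)) as R1.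
  pose proof (rapid_iter_mulZ j _ (rapid_nome q' rho Hr Hq')) as R2.
  unfold nome_sum.
  replace (Zsum (Nat.iter j mulZ (nome_weight q)) - Zsum (Nat.iter j mulZ (nome_weight q')))
    with (Zsum (fun n => Nat.iter j mulZ (nome_weight q) n
                         + - (1) * Nat.iter j mulZ (nome_weight q') n)).
  2: { rewrite Zsum_plus, Zsum_scal by auto using rapid_scal. ring. }
  eapply Rle_trans; [apply (Zsum_bound (K / rho * Cmod (q - q')))|right; ring].
  intros n. specialize (HK n). rewrite !iter_mulZ in *.
  unfold nome_weight in *. set (k := (Z.abs_nat n * Z.abs_nat n)%nat) in *.
  replace (IZR n ^ j * q ^ k + - (1) * (IZR n ^ j * q' ^ k)) with (IZR n ^ j * (q ^ k - q' ^ k)) by ring.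
  rewrite Cmod_mult. pose proof (pow_diff_bound q q' rho k (proj1 Hr) Hq Hq') as D.
  rewrite Cpow_add_r, !Cmod_mult, !Cmod_pow, !Cmod_R, (Rabs_pos_eq rho), pow2_abs in HK by lra.
  replace (IZR n ^ 2)%R with (INR k) in HK.
  2: { unfold k. rewrite INR_abs_sqr. ring. }
  rewrite Cmod_pow, Cmod_R.
  apply Rle_trans with (Rabs (IZR n) ^ j * (INR k * rho ^ k / rho * Cmod (q - q')))%R.
  { apply Rmult_le_compat_l; [apply pow_le, Rabs_pos | exact D]. }
  replace (Rabs (IZR n) ^ j * (INR k * rho ^ k / rho * Cmod (q - q')))%R
    with (INR k * Rabs (IZR n) ^ j * rho ^ k * (Cmod (q - q') / rho))%R by (field; lra).
  replace (K / rho * Cmod (q - q') * exp (- Rabs (IZR n)))%R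
    with (K * exp (- Rabs (IZR n)) * (Cmod (q - q') / rho))%R by (field; lra).
  apply Rmult_le_compat_r; [apply Rdiv_le_0_compat; [apply Cmod_ge_0 | lra] | exact HK].
Qed.

Lemma has_sum_conj {I} (f : I -> C) l : has_sum f l -> has_sum (fun i => Cconj (f i)) (Cconj l).
Proof.
  intros H e He; destruct (H e He) as (L0 & HL); exists L0; intros L Hn Hi.
  replace (lsum (fun i => Cconj (f i)) L) with (Cconj (lsum f L)).
  - rewrite <- Cminus_conj, Cmod_conj; now apply HL.
  - clear. induction L as [|i L IH]; simpl; [apply injective_projections; simpl; ring|].
    now rewrite Cplus_conj, IH.
Qed.

Lemma nome_sum_conj j q rho : (0 < rho < 1)%R -> (Cmod q <= rho)%R ->
  nome_sum j (Cconj q) = Cconj (nome_sum j q).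
Proof.
  intros Hr Hq. unfold nome_sum.
  assert (Hq' : (Cmod (Cconj q) <= rho)%R) by now rewrite Cmod_conj.
  apply (has_sum_unique (Nat.iter j mulZ (nome_weight (Cconj q)))).
  - now apply has_sum_rapid, rapid_iter_mulZ, (rapid_nome _ rho).
  - eapply has_sum_ext; [|apply has_sum_conj, has_sum_rapid, rapid_iter_mulZ,
      (rapid_nome q rho Hr Hq)].
    intros n; cbv beta. rewrite !iter_mulZ. unfold nome_weight.
    rewrite Cmult_conj, !Cpow_conj. f_equal. f_equal.
    apply injective_projections; simpl; ring.
Qed.

(** * Truncating the nome sums, with tails starting at q^25 *)

Definition core : list Z := [0; 1; -1; 2; -2; 3; -3; 4; -4]%Z.

(* 243 = 3^5: the right-hand side is the value at k = 5. *)
Lemma nome_tail_step rho k : (0 <= rho <= 19 / 30)%R -> (5 <= k)%nat ->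
  (INR k ^ 2 * rho ^ (k * k) * 3 ^ k <= 25 * 243 * rho ^ 25)%R.
Proof.
  intros Hr Hk; induction Hk as [|k Hk IH]; [simpl; lra|].
  eapply Rle_trans; [|exact IH].
  (* From k to k + 1 the exponent grows by at least 11; rho^11 <= 1/12 outweighs the factor 3 ((k +
     1)/k)^2, at most 3 * 36/25. *)
  replace (S k * S k)%nat with (k * k + (11 + (2 * k - 10)))%nat by lia.
  rewrite !pow_add.
  assert (H5 : (5 <= INR k)%R) by (replace 5%R with (INR 5) by (simpl; lra); now apply le_INR).
  assert (P1 : (0 <= rho ^ (2 * k - 10) <= 1)%R).
  { split; [apply pow_le; lra|]. rewrite <- (pow1 (2 * k - 10)). apply pow_incr; lra. }
  assert (P2 : (0 <= rho ^ 11 <= 1 / 12)%R).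
  { split; [apply pow_le; lra|]. apply Rle_trans with ((19 / 30) ^ 11)%R;
      [apply pow_incr; lra | lra]. }
  assert (P3 : (0 <= rho ^ 11 * rho ^ (2 * k - 10) <= 1 / 12)%R) by nra.
  set (y := (rho ^ 11 * rho ^ (2 * k - 10))%R) in *.
  set (z := (rho ^ (k * k) * 3 ^ k)%R).
  assert (Hz : (0 <= z)%R) by (apply Rmult_le_pos; apply pow_le; lra).
  replace (INR (S k) ^ 2 * (rho ^ (k * k) * y) * 3 ^ S k)%R
    with (INR (S k) ^ 2 * (3 * y) * z)%R by (unfold z; simpl; ring).
  replace (INR k ^ 2 * rho ^ (k * k) * 3 ^ k)%R with (INR k ^ 2 * z)%R by (unfold z; ring).
  apply Rmult_le_compat_r; [exact Hz|]. rewrite S_INR. nra.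
Qed.

Lemma geo_const_le : (geo_const <= 4)%R.
Proof.
  unfold geo_const. pose proof exp_m1_lt_1 as H.
  assert (exp (-1) <= / 2)%R.
  { replace (-1)%R with (- (1))%R by ring. rewrite exp_Ropp. apply Rinv_le_contravar; [lra|].
    pose proof (exp_ineq1_le 1); lra. }
  apply Rmult_le_reg_r with (1 - exp (-1))%R; [lra|].
  unfold Rdiv; rewrite Rmult_assoc, Rinv_l; lra.
Qed.

Lemma inv3_pow_le_exp k : (/ 3 ^ k <= exp (- INR k))%R.
Proof.
  rewrite exp_INR. replace (/ 3 ^ k)%R with ((/ 3) ^ k)%R by (now rewrite pow_inv).
  apply pow_incr; split; [lra|].
  replace (-1)%R with (- (1))%R by ring. rewrite exp_Ropp.
  apply Rinv_le_contravar; [apply exp_pos | apply exp_le_3].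
Qed.

(** Each tail term is at most 25 * 243 rho^25 times 3^(-|n|), hence times exp(-|n|); the sum over Z
    costs [geo_const] <= 4. *)
Lemma nome_sum_core j q rho : (j <= 2)%nat -> (0 < rho <= 19 / 30)%R -> (Cmod q <= rho)%R ->
  (Cmod (nome_sum j q - lsum (Nat.iter j mulZ (nome_weight q)) core)
   <= 100 * 243 * rho ^ 25)%R.
Proof.
  intros Hj Hr Hq. set (f := Nat.iter j mulZ (nome_weight q)).
  assert (Hf : rapid f) by (apply rapid_iter_mulZ, (rapid_nome q rho); lra).
  set (h := fun n => if in_dec Z.eq_dec n core then RtoC 0 else f n).
  set (d := fun n => if in_dec Z.eq_dec n core then f n else RtoC 0).
  assert (Hn : NoDup core) by (unfold core; repeat constructor; simpl; lia).
  assert (Hh : exp_bounded (25 * 243 * rho ^ 25) h).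
  { intros n; unfold h. destruct (in_dec Z.eq_dec n core) as [_|Hni].
    - rewrite Cmod_0. apply Rmult_le_pos; [|left; apply exp_pos].
      apply Rmult_le_pos; [lra | apply pow_le; lra].
    - assert (Hk : (5 <= Z.abs_nat n)%nat) by (unfold core in Hni; simpl in Hni; lia).
      set (k := Z.abs_nat n) in *.
      assert (En : Rabs (IZR n) = INR k).
      { unfold k; now rewrite INR_IZR_INZ, Zabs2Nat.id_abs, abs_IZR. }
      unfold f; rewrite iter_mulZ, Cmod_mult, Cmod_pow, Cmod_R, En.
      unfold nome_weight; fold k.
      pose proof (nome_tail_step rho k ltac:(lra) Hk) as T.
      assert (H1k : (1 <= INR k)%R)
        by (replace 1%R with (INR 1) by reflexivity; apply le_INR; lia).
      apply Rle_trans with (INR k ^ 2 * rho ^ (k * k))%R.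
      + apply Rmult_le_compat; [apply pow_le; lra | apply Cmod_ge_0 | now apply Rle_pow
          | now apply Cmod_pow_le].
      + apply Rle_trans with (25 * 243 * rho ^ 25 * / 3 ^ k)%R.
        * assert (0 < 3 ^ k)%R by (apply pow_lt; lra).
          apply Rmult_le_reg_r with (3 ^ k)%R; [assumption|].
          rewrite (Rmult_assoc _ (/ 3 ^ k)), Rinv_l; lra.
        * apply Rmult_le_compat_l; [|apply inv3_pow_le_exp].
          apply Rmult_le_pos; [lra | apply pow_le; lra]. }
  assert (E : nome_sum j q = lsum f core + Zsum h).
  { apply (has_sum_unique f); [now apply has_sum_rapid|].
    apply (has_sum_ext (fun n => d n + h n)).
    - intros n; unfold d, h; destruct (in_dec _ _ _); ring.
    - apply has_sum_plus; [|exact (has_sum_Zsum _ h Hh)].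
      replace (lsum f core) with (lsum d core).
      + intros e He; exists core; intros L HnL Hi.
        rewrite (lsum_finite_support d core L); auto.
        * replace (lsum d core - lsum d core) with (RtoC 0) by ring. now rewrite Cmod_0.
        * intros i _ Hi'; unfold d; now destruct (in_dec _ _ _).
      + apply lsum_ext; intros i Hi; unfold d; now destruct (in_dec _ _ _). }
  rewrite E. replace (lsum f core + Zsum h - lsum f core) with (Zsum h) by ring.
  eapply Rle_trans; [apply (Zsum_bound _ h Hh)|].
  assert (0 <= 25 * 243 * rho ^ 25)%R
    by (apply Rmult_le_pos; [lra | apply pow_le; lra]).
  pose proof geo_const_le; nra.
Qed.

Lemma core_sum_0 q :
  lsum (Nat.iter 0 mulZ (nome_weight q)) core = 1 + 2 * (q + q ^ 4 + q ^ 9 + q ^ 16).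
Proof.
  unfold core, nome_weight; simpl lsum;
  cbv [Z.abs_nat Pos.to_nat Pos.iter_op Nat.mul Nat.add]. ring.
Qed.

Lemma core_sum_2 q :
  lsum (Nat.iter 2 mulZ (nome_weight q)) core = 2 * (q + 4 * q ^ 4 + 9 * q ^ 9 + 16 * q ^ 16).
Proof.
  unfold core, nome_weight; simpl lsum; unfold mulZ;
  cbv [Z.abs_nat Pos.to_nat Pos.iter_op Nat.mul Nat.add].
  replace (RtoC (IZR (-1))) with (- (1)) by (rewrite <- RtoC_opp; f_equal; lra).
  replace (RtoC (IZR (-2))) with (- (2)) by (rewrite <- RtoC_opp; f_equal; lra).
  replace (RtoC (IZR (-3))) with (- (3)) by (rewrite <- RtoC_opp; f_equal; lra).
  replace (RtoC (IZR (-4))) with (- (4)) by (rewrite <- RtoC_opp; f_equal; lra).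
  ring.
Qed.

(** * Two conjugate parameters with the same variance *)

(** The integer slope makes the coefficients of the powers of q Gaussian integers. *)
Definition ray (t : R) : C := (t, (- 3 * t)%R).

Lemma Cmod_le_sqr z rho : (0 <= rho)%R -> (Re z ^ 2 + Im z ^ 2 <= rho ^ 2)%R -> (Cmod z <= rho)%R.
Proof.
  intros Hr H. unfold Cmod. rewrite <- (sqrt_pow2 rho Hr). apply sqrt_le_1_alt. exact H.
Qed.

Lemma ray_powers t :
  ray t ^ 4 = (28 * t ^ 4, 96 * t ^ 4)%R /\
  ray t ^ 9 = (7696 * t ^ 9, 30672 * t ^ 9)%R /\
  ray t ^ 16 = (42197248 * t ^ 16, - 90660864 * t ^ 16)%R.
Proof.
  assert (H4 : ray t ^ 4 = (28 * t ^ 4, 96 * t ^ 4)%R)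
    by (apply injective_projections; simpl; ring).
  split; [exact H4 | split].
  - replace (ray t ^ 9) with (ray t * (ray t ^ 4 * ray t ^ 4)) by ring. rewrite H4.
    apply injective_projections; simpl; ring.
  - replace (ray t ^ 16) with ((ray t ^ 4 * ray t ^ 4) * (ray t ^ 4 * ray t ^ 4)) by ring.
    rewrite H4. apply injective_projections; simpl; ring.
Qed.

(** The nome has modulus sqrt(10) t; the values 1/3 and 19/30 of [rho] lie just above it at t = 1/10
    and t = 1/5. *)
Lemma ray_sums t rho : (0 < rho <= 19 / 30)%R -> (10 * t ^ 2 <= rho ^ 2)%R ->
  let e := (100 * 243 * rho ^ 25)%R in
  let T := nome_sum 0 (ray t) in
  let S := nome_sum 2 (ray t) in
  (Rabs (Re T - (1 + 2 * (t + 28 * t ^ 4 + 7696 * t ^ 9 + 42197248 * t ^ 16))) <= e /\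
   Rabs (Im T - 2 * (- 3 * t + 96 * t ^ 4 + 30672 * t ^ 9 - 90660864 * t ^ 16)) <= e /\
   Rabs (Re S - 2 * (t + 4 * 28 * t ^ 4 + 9 * 7696 * t ^ 9 + 16 * 42197248 * t ^ 16)) <= e /\
   Rabs (Im S - 2 * (- 3 * t + 4 * 96 * t ^ 4 + 9 * 30672 * t ^ 9 - 16 * 90660864 * t ^ 16)) <= e)%R.
Proof.
  intros Hr Ht e T S.
  assert (Hq : (Cmod (ray t) <= rho)%R)
    by (apply Cmod_le_sqr; [lra | unfold Re, Im; simpl; simpl in Ht; lra]).
  pose proof (nome_sum_core 0 (ray t) rho ltac:(lia) Hr Hq) as H0.
  pose proof (nome_sum_core 2 (ray t) rho ltac:(lia) Hr Hq) as H2.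
  rewrite core_sum_0 in H0; rewrite core_sum_2 in H2.
  destruct (ray_powers t) as (E4 & E9 & E16). rewrite E4, E9, E16 in H0, H2.
  fold e T S in H0, H2.
  pose proof (Rle_trans _ _ _ (re_le_Cmod _) H0) as R0.
  pose proof (Rle_trans _ _ _ (im_le_Cmod _) H0) as I0.
  pose proof (Rle_trans _ _ _ (re_le_Cmod _) H2) as R2.
  pose proof (Rle_trans _ _ _ (im_le_Cmod _) H2) as I2.
  split; [|split; [|split]].
  - eapply Rle_trans; [right | exact R0]. f_equal; unfold Re, Im; simpl; ring.
  - eapply Rle_trans; [right | exact I0]. f_equal; unfold Re, Im; simpl; ring.
  - eapply Rle_trans; [right | exact R2]. f_equal; unfold Re, Im; simpl; ring.
  - eapply Rle_trans; [right | exact I2]. f_equal; unfold Re, Im; simpl; ring.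
Qed.

(** The imaginary part of S times the conjugate of T, with S and T the sums for j = 2 and j = 0;
    where T is nonzero, it vanishes exactly when the variance S/T is real. *)
Definition ray_cross (t : R) : R :=
  (Im (nome_sum 2 (ray t)) * Re (nome_sum 0 (ray t))
   - Re (nome_sum 2 (ray t)) * Im (nome_sum 0 (ray t)))%R.

(** The intermediate value theorem does not locate t, so theta must be nonzero on the whole
    segment. *)
Lemma Re_theta_ray_pos t : (1 / 10 <= t <= 1 / 5)%R -> (0 < Re (nome_sum 0 (ray t)))%R.
Proof.
  intros Ht. destruct (ray_sums t (19 / 30)) as (H & _); [lra | nra |].
  apply Rabs_le_between in H.
  assert (0 <= t ^ 4 /\ 0 <= t ^ 9 /\ 0 <= t ^ 16)%R by (repeat split; apply pow_le; lra).
  lra.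
Qed.

Lemma ray_cross_neg : (ray_cross (1 / 10) < 0)%R.
Proof.
  destruct (ray_sums (1 / 10) (1 / 3)) as (H1 & H2 & H3 & H4); [lra | lra |].
  apply Rabs_le_between in H1. apply Rabs_le_between in H2.
  apply Rabs_le_between in H3. apply Rabs_le_between in H4.
  unfold ray_cross. set (a := Re (nome_sum 0 _)) in *. set (b := Im (nome_sum 0 _)) in *.
  set (c := Re (nome_sum 2 _)) in *. set (d := Im (nome_sum 2 _)) in *.
  assert (1.2 <= a <= 1.21)%R by lra. assert (-0.59 <= b <= -0.57)%R by lra.
  assert (0.2 <= c <= 0.23)%R by lra. assert (-0.6 <= d <= -0.5)%R by lra.
  nra.
Qed.

Lemma ray_cross_pos : (0 < ray_cross (1 / 5))%R.
Proof.
  destruct (ray_sums (1 / 5) (19 / 30)) as (H1 & H2 & H3 & H4); [lra | lra |].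
  apply Rabs_le_between in H1. apply Rabs_le_between in H2.
  apply Rabs_le_between in H3. apply Rabs_le_between in H4.
  unfold ray_cross. set (a := Re (nome_sum 0 _)) in *. set (b := Im (nome_sum 0 _)) in *.
  set (c := Re (nome_sum 2 _)) in *. set (d := Im (nome_sum 2 _)) in *.
  assert (1.2 <= a)%R by lra. assert (b <= -0.55)%R by lra.
  assert (0.5 <= c)%R by lra. assert (0.01 <= d)%R by lra.
  nra.
Qed.

Lemma lipschitz_continuity_pt (f : R -> R) (a b L x : R) : (a < x < b)%R ->
  (forall y, (a < y < b)%R -> (Rabs (f y - f x) <= L * Rabs (y - x))%R) -> continuity_pt f x.
Proof.
  intros Hx H e He.
  pose proof (Rabs_pos L) as HL.
  exists (Rmin (Rmin (x - a) (b - x)) (e / (Rabs L + 1))). split.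
  - apply Rmin_pos; [apply Rmin_pos; lra | apply Rdiv_lt_0_compat; lra].
  - intros y (_ & Hy). simpl in *. unfold Rdist in *.
    pose proof (Rmin_l (Rmin (x - a) (b - x)) (e / (Rabs L + 1))).
    pose proof (Rmin_r (Rmin (x - a) (b - x)) (e / (Rabs L + 1))).
    pose proof (Rmin_l (x - a) (b - x)). pose proof (Rmin_r (x - a) (b - x)).
    assert (Hab : (a < y < b)%R) by (apply Rabs_lt_between in Hy; lra).
    eapply Rle_lt_trans; [apply (H y Hab)|].
    pose proof (Rle_abs L). pose proof (Rabs_pos (y - x)) as Hd.
    apply Rle_lt_trans with (Rabs L * (e / (Rabs L + 1)))%R.
    + apply Rle_trans with (Rabs L * Rabs (y - x))%R;
        [apply Rmult_le_compat_r | apply Rmult_le_compat_l]; lra.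
    + apply Rmult_lt_reg_r with (Rabs L + 1)%R; [lra|].
      replace (Rabs L * (e / (Rabs L + 1)) * (Rabs L + 1))%R with (Rabs L * e)%R by (field; lra).
      nra.
Qed.

Lemma nome_sum_ray_continuity j t : (0 < t < 1 / 4)%R ->
  continuity_pt (fun t => Re (nome_sum j (ray t))) t /\
  continuity_pt (fun t => Im (nome_sum j (ray t))) t.
Proof.
  (* 4/5 exceeds sqrt(10)/4, the modulus at the right end of the interval. *)
  intros Ht. destruct (nome_sum_lipschitz j (4 / 5) ltac:(lra)) as (L & HL).
  assert (Hray : forall s, (0 < s < 1 / 4)%R -> (Cmod (ray s) <= 4 / 5)%R).
  { intros s Hs; apply Cmod_le_sqr; [lra | unfold Re, Im; simpl; nra]. }
  assert (Hd : forall s, (0 < s < 1 / 4)%R ->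
    (Cmod (nome_sum j (ray s) - nome_sum j (ray t)) <= L * Cmod (1, -3)%R * Rabs (s - t))%R).
  { intros s Hs. eapply Rle_trans; [apply HL; auto|].
    replace (ray s - ray t) with ((1, -3)%R * RtoC (s - t))
      by (apply injective_projections; simpl; ring).
    rewrite Cmod_mult, Cmod_R. right; ring. }
  split; apply (lipschitz_continuity_pt _ 0 (1 / 4) (L * Cmod (1, -3)%R)); auto;
    intros s Hs; (eapply Rle_trans; [|apply (Hd s Hs)]).
  - eapply Rle_trans; [|apply re_le_Cmod]. right; f_equal.
  - eapply Rle_trans; [|apply im_le_Cmod]. right; f_equal.
Qed.

Lemma ray_cross_zero : exists t, (1 / 10 <= t <= 1 / 5)%R /\ ray_cross t = 0%R.
Proof.
  destruct (Ranalysis5.IVT_interv ray_cross (1 / 10) (1 / 5)) as (t & Ht & E).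
  - intros t Ht.
    destruct (nome_sum_ray_continuity 0 t) as (C0 & C1); [lra|].
    destruct (nome_sum_ray_continuity 2 t) as (C2 & C3); [lra|].
    unfold ray_cross.
    apply (continuity_pt_minus
      (fun t => Im (nome_sum 2 (ray t)) * Re (nome_sum 0 (ray t)))%R
      (fun t => Re (nome_sum 2 (ray t)) * Im (nome_sum 0 (ray t)))%R).
    + now apply (continuity_pt_mult (fun t => Im (nome_sum 2 (ray t)))).
    + now apply (continuity_pt_mult (fun t => Re (nome_sum 2 (ray t)))).
  - lra.
  - apply ray_cross_neg.
  - apply ray_cross_pos.
  - now exists t.
Qed.

Lemma ray_is_nome t : (0 < t <= 1 / 5)%R ->
  exists B, H1 B /\ bfe (- (1 / 2) * B) = ray t /\ bfe (- (1 / 2) * Cconj B) = Cconj (ray t).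
Proof.
  intros Ht. pose proof PI_RGT_0 as HPI.
  set (s := sqrt (1 + Rsqr 3)).
  assert (Hs0 : (0 < s)%R) by (apply sqrt_lt_R0; unfold Rsqr; lra).
  assert (Hs4 : (s < 4)%R).
  { unfold s. rewrite <- (sqrt_pow2 4) by lra. apply sqrt_lt_1_alt. unfold Rsqr; lra. }
  (* A logarithm of t(1 - 3i), which has modulus t sqrt(10) and argument -atan 3, divided by -pi. *)
  exists (- ln (t * s) / PI, atan 3 / PI)%R.
  assert (Hts : (0 < t * s < 1)%R) by nra.
  split; [|split].
  - unfold H1, Re; simpl. apply Rdiv_lt_0_compat; [|lra].
    enough (ln (t * s) < ln 1)%R by (rewrite ln_1 in *; lra).
    apply ln_increasing; lra.
  - unfold bfe.
    replace (2 * PI * (- (1 / 2) * (- ln (t * s) / PI, atan 3 / PI)%R))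
      with (ln (t * s), - atan 3)%R by (apply injective_projections; simpl; field; lra).
    unfold Cexp, Re, Im, ray; simpl. rewrite exp_ln, cos_neg, sin_neg, cos_atan, sin_atan by lra.
    fold s. apply injective_projections; simpl; field; lra.
  - unfold bfe.
    replace (2 * PI * (- (1 / 2) * Cconj (- ln (t * s) / PI, atan 3 / PI)%R))
      with (ln (t * s), atan 3)%R by (apply injective_projections; simpl; field; lra).
    unfold Cexp, Re, Im, ray; simpl. rewrite exp_ln, cos_atan, sin_atan by lra.
    fold s. apply injective_projections; simpl; field; lra.
Qed.

Lemma gauss_moment_nome j B : gauss_moment j 0 B = nome_sum j (bfe (- (1 / 2) * B)).
Proof.
  unfold gauss_moment, nome_sum. do 2 f_equal.
  apply functional_extensionality; intros n; apply gauss_weight_nome.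
Qed.

Lemma centred_moment_1 B : H1 B -> theta 0 B <> 0 -> moment 1 0 B = 0.
Proof.
  intros HB Ht. pose proof (gauss_moment_opp 1 0 B HB) as E.
  replace (- RtoC 0) with (RtoC 0) in E by ring.
  rewrite gauss_moment_eq in E by assumption.
  destruct (Cmult_integral (2 * theta 0 B) (moment 1 0 B)) as [Z|Z]; auto.
  - transitivity (theta 0 B * moment 1 0 B - (- (1)) ^ 1 * (theta 0 B * moment 1 0 B));
      [simpl; ring|]. rewrite <- E; ring.
  - exfalso; revert Z; apply Cmult_neq_0; [apply two_neq_0 | assumption].
Qed.

Lemma Cmult_eq_reg_l (z x y : C) : z * x = z * y -> z <> 0 -> x = y.
Proof.
  intros H Hz. apply Ceq_minus. destruct (Cmult_integral z (x - y)) as [E|E]; auto.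
  - transitivity (z * x - z * y); [ring|]. rewrite H; ring.
  - contradiction.
Qed.

Lemma two_moments_insufficient : exists u B u' B' : C,
  (H1 B /\ ~ Theta1 u B) /\ (H1 B' /\ ~ Theta1 u' B') /\ B <> B' /\
  same_moments 2 u B u' B' /\ ~ same_distribution u B u' B'.
Proof.
  destruct ray_cross_zero as (t & Ht & Hc).
  destruct (ray_is_nome t) as (B & HB & Hq & Hq'); [lra|].
  assert (HB' : H1 (Cconj B)) by (unfold H1 in *; destruct B; exact HB).
  assert (Hr : (Cmod (ray t) <= 4 / 5)%R)
    by (apply Cmod_le_sqr; [lra | unfold Re, Im; simpl; nra]).
  pose proof (Re_theta_ray_pos t Ht) as HRe.
  assert (Eth : theta 0 B = nome_sum 0 (ray t)) by (rewrite <- Hq; exact (gauss_moment_nome 0 B)).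
  assert (Eth' : theta 0 (Cconj B) = Cconj (nome_sum 0 (ray t))).
  { rewrite <- (nome_sum_conj 0 (ray t) (4 / 5)), <- Hq' by (auto; lra).
    exact (gauss_moment_nome 0 (Cconj B)). }
  assert (Hth : theta 0 B <> 0).
  { rewrite Eth; intros Z; rewrite Z in HRe; simpl in HRe; lra. }
  assert (Hth' : theta 0 (Cconj B) <> 0).
  { rewrite Eth'; intros Z. apply (f_equal Re) in Z.
    change (Re (nome_sum 0 (ray t)) = 0%R) in Z. lra. }
  assert (Hdist : ~ same_distribution 0 B 0 (Cconj B)).
  (* The ratio of the values at 1 and 0 recovers the nome, which is not real. *)
  { intros Hd. pose proof (Hd 0%Z) as D0. pose proof (Hd 1%Z) as D1.
    unfold p_theta in D0, D1. rewrite !gauss_weight_nome, Hq, Hq' in D0, D1.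
    unfold nome_weight in D0, D1. simpl Cpow in D0, D1.
    rewrite !Cmult_1_r in D0, D1. rewrite D0 in D1.
    assert (E : ray t = Cconj (ray t)).
    { transitivity (theta 0 (Cconj B) * (1 / theta 0 (Cconj B) * ray t)); [now field|].
      rewrite D1. now field. }
    apply (f_equal Im) in E. unfold Im in E; simpl in E. lra. }
  exists 0, B, 0, (Cconj B).
  split; [split; [exact HB | intros (_ & Z); contradiction]|].
  split; [split; [exact HB' | intros (_ & Z); contradiction]|].
  split; [intros E; apply Hdist; rewrite <- E; intros n; reflexivity|].
  split; [|exact Hdist].
  intros k Hk. assert (Hk' : k = 1%nat \/ k = 2%nat) by lia. destruct Hk' as [-> | ->].
  - now rewrite !centred_moment_1.
  - pose proof (gauss_moment_eq 2 0 B HB Hth) as M.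
    pose proof (gauss_moment_eq 2 0 (Cconj B) HB' Hth') as M'.
    rewrite gauss_moment_nome, Hq, Eth in M.
    rewrite gauss_moment_nome, Hq', (nome_sum_conj 2 (ray t) (4 / 5)), Eth' in M' by (auto; lra).
    rewrite Eth in Hth. rewrite Eth' in Hth'.
    (* The vanishing of [ray_cross] at t: this product is real, so the conjugate variances
       coincide. *)
    assert (X : nome_sum 2 (ray t) * Cconj (nome_sum 0 (ray t))
                = Cconj (nome_sum 2 (ray t)) * nome_sum 0 (ray t)).
    { unfold ray_cross in Hc. unfold Re, Im in Hc.
      apply injective_projections; cbn [Cmult Cconj fst snd]; lra. }
    set (T := nome_sum 0 (ray t)) in *.
    apply (Cmult_eq_reg_l (T * Cconj T)); [|now apply Cmult_neq_0].
    transitivity (T * moment 2 0 B * Cconj T); [ring|].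
    rewrite <- M, X, M'. ring.
Qed.

Theorem theorem5p9 :
  (forall B u u' : C,
      H1 B -> theta u B <> 0 -> theta u' B <> 0 ->
      same_moments 3 u B u' B ->
      same_distribution u B u' B)
  /\
  (exists u B u' B' : C,
      (H1 B /\ ~ Theta1 u B) /\
      (H1 B' /\ ~ Theta1 u' B') /\
      B <> B' /\
      same_moments 2 u B u' B' /\
      ~ same_distribution u B u' B').
Proof.
  split; [exact three_moments_determine | exact two_moments_insufficient].
Qed.
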